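(* Let $N>1$ be an integer, let $\chi$ be a primitive Dirichlet character modulo $N$, and let $1/2<s<1$. Define \[ m_{s,\chi}(x)=\sum_{n=1}^{\infty}\frac{\chi(n)\,e^{-2\pi i n^2 x}}{n^s},\qquad x\in[0,1]. \] Then $m_{s,\chi}$ belongs to weak-type $L^{2/(1-s)}[0,1]$; that is, there is a constant $c$ such that $|\{x\in[0,1]: |m_{s,\chi}(x)|>\alpha\}|\le c\,\alpha^{-2/(1-s)}$ for all $\alpha>0$.
   Context: Since $s>1/2$, the coefficients $\chi(n)n^{-s}$ are square-summable, so the series defining $m_{s,\chi}$ converges in $L^2[0,1]$ and defines a function in $L^2[0,1]$. For $r>0$, a function $g$ on $[0,1]$ is of weak-type $L^r[0,1]$ if $|\{x\in[0,1]: |g(x)|>\alpha\}|\le c\,\alpha^{-r}$ for all $\alpha>0$, with $c$ independent of $\alpha$; $|\cdot|$ denotes Lebesgue measure. *)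

(* Defs.v *)
From HB Require Import structures.
From mathcomp Require Import all_boot all_order all_algebra.
From mathcomp Require Import all_classical all_reals all_analysis.
From mathcomp Require Import complex.
Set Implicit Arguments. Unset Strict Implicit. Unset Printing Implicit Defensive.
Import Order.TTheory GRing.Theory Num.Theory.
Import numFieldNormedType.Exports.
Local Open Scope classical_set_scope.
Local Open Scope ring_scope.

Definition interval01 (R : realType) : set R := `[0%R, 1%R].
Arguments interval01 R : clear implicits.

Definition cmod (R : realType) (z : R[i]) : R :=
  Num.sqrt ((complex.Re z) ^+ 2 + (complex.Im z) ^+ 2).

(* Dirichlet character modulo N, as a function on positive integers
   (values at n = 0 are irrelevant; we use the natural-number version). *)
Definition dirichlet_character (R : realType) (N : nat) (chi : nat -> R[i]) : Prop :=
  [/\ chi 1%N = 1,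
      (forall m n : nat, chi (m * n)%N = chi m * chi n),
      (forall n : nat, chi (n + N)%N = chi n) &
      (forall n : nat, chi n = 0 <-> ~~ coprime n N)].

(* Primitive: chi is not induced by a character of smaller modulus, i.e.
   for every proper divisor d of N there is a with (a,N)=1, a = 1 mod d
   and chi a <> 1. *)
Definition primitive_character (R : realType) (N : nat) (chi : nat -> R[i]) : Prop :=
  dirichlet_character N chi /\
  forall d : nat, (d %| N)%N -> (d < N)%N ->
    exists a : nat, [/\ coprime a N, a = 1 %[mod d] & chi a <> 1].

Definition mterm (R : realType) (s : R) (chi : nat -> R[i]) (n : nat) (x : R) : R[i] :=
  chi n * ((n%:R `^ (- s)) * cos (2 * pi * (n ^ 2)%N%:R * x)
            -i* ((n%:R `^ (- s)) * sin (2 * pi * (n ^ 2)%N%:R * x)))%C.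

Definition mpartial (R : realType) (s : R) (chi : nat -> R[i]) (K : nat) (x : R) : R[i] :=
  \sum_(1 <= n < K.+1) mterm s chi n x.

Definition is_L2_limit_on01 (R : realType) (s : R) (chi : nat -> R[i]) (f : R -> R[i]) : Prop :=
  [/\ measurable_fun (interval01 R) (fun x => complex.Re (f x)),
      measurable_fun (interval01 R) (fun x => complex.Im (f x)) &
      ((fun K : nat => (\int[lebesgue_measure]_(x in (interval01 R))
           ((cmod (mpartial s chi K x - f x)) ^+ 2)%:E)%E) @ \oo --> 0%E)].

(* Main.v *)
Require Import Defs.
From HB Require Import structures.
From mathcomp Require Import all_boot all_order all_algebra.
From mathcomp Require Import all_classical all_reals all_analysis.
From mathcomp Require Import complex measurable_realfun.
From mathcomp Require Import ring lra zify.
Set Implicit Arguments. Unset Strict Implicit. Unset Printing Implicit Defensive.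
Import Order.TTheory GRing.Theory Num.Theory.
Import numFieldNormedType.Exports.
Local Open Scope classical_set_scope.
Local Open Scope ring_scope.

(** Split [n = N k + r] and cut [k] into dyadic blocks [M <= k < 2M], [M = 2^j].
    Put [y = 2 N^2 x] and let [a/q], [q <= 2M], be a Dirichlet approximation of [y].
    Weyl differencing and Abel summation bound a block by
      [M^(1/2 + eps - s) + M^(1-s) q^(-1/2) max(1, M^2 |y - a/q|)^(-3/8)].
    The first terms sum to a constant since [s > 1/2]. The second term, the [peak],
    exceeds [tau] only on a union of intervals around rationals of total length
    [O(M^(2-4s) tau^(-4))]. For a level [alpha], the blocks with
    [2^(j(1-s))] much smaller than [alpha] are harmless; for the others one takes
    thresholds [tau_j] decreasing geometrically from [alpha], and the exceptional
    measures add up to [O(alpha^(-2/(1-s)))]. This is uniform in the partial sum and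
    passes to the L^2 limit by Chebyshev's inequality. The limit exists by Parseval
    and Fatou along the partial sums of length [2^j]. *)

(** * Weyl differencing for quadratic phases *)

(** The estimate is an endpoint one: the main term may lose neither a logarithm nor a power [M^eps].
    Such losses are affordable only in the differences [h] not divisible by [q], where [s > 1/2]
    leaves room. This dictates the exponent of the peak. The differences divisible by [q] contribute
    [(M^2 / q) X^(-theta)] with [X = max(1, M^2 |y - a/q|)]; here [theta = 1] would cost the
    logarithm of a harmonic sum, while [theta < 1] does not. Conversely, a peak above [tau] confines
    [y] to radius [M^(-2) (Q/q)^(1/theta)] around [a/q], where [Q = (M^(1-s) / tau)^2]. With about
    [q] numerators for each [q <= Q], the total is of order [M^(-2) Q^2] only if [theta > 1/2]. The
    choice [theta = 3/4] is the midpoint, and becomes [3/8] after a square root. For the first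
    relevant block, [M^(1-s)] and [tau] are both comparable to [alpha], so [Q] is of order 1 and the
    measure is [M^(-2) = alpha^(-2/(1-s))] up to constants: this is the origin of the exponent.
    Later blocks gain because [2 - 4s < 0], which pays for the decreasing thresholds. *)

Lemma sin_ge_half (R : realType) (t : R) : 0 <= t <= pi / 2 -> t / 2 <= sin t.
Proof.
move=> /andP[t0 tpi].
have pi0 := @pi_gt0 R; have pi4 := @pihalf_lt2 R.
have cos4 : cos (pi / 4 : R) ^+ 2 = 1 / 2.
  have : cos ((pi / 4 : R) *+ 2) = 0.
    by rewrite (_ : _ *+ 2 = pi / 2) ?cos_pihalf// mulr2n; lra.
  by rewrite cos_mulr2n => h; lra.
have cosge (u : R) : 0 <= u <= pi / 4 -> cos (pi / 4) <= cos u.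
  move=> /andP[u0 u4]; rewrite leNgt; apply/negP => h.
  move: h; rewrite ltr_cos ?in_itv/=; [by lra|by apply/andP; split; lra..].
have cos40 : 0 <= cos (pi / 4 : R) by apply: cos_ge0_pihalf; lra.
have := t0; rewrite le_eqVlt => /orP[/eqP <-|t_gt0].
  by rewrite sin0 mul0r.
have [c] := @MVT R sin cos 0 (t / 2) ltac:(lra) (fun x _ => is_derive_sin x)
  (continuous_subspaceT (@continuous_sin R)).
rewrite in_itv/= sin0 !subr0 => /andP[c0 ct] sint.
(* The mean value theorem on all of [[0, t]] could give a vanishing cosine. After halving the angle,
   both cosines are at least [cos (pi / 4)], so their product is at least [1 / 2]. *)
rewrite [in leRHS](_ : t = (t / 2) *+ 2); last by rewrite mulr2n; lra.
rewrite sin_mulr2n sint.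
have h1 := cosge c ltac:(lra); have h2 := cosge (t / 2) ltac:(lra).
have : cos (pi / 4) ^+ 2 <= cos (t / 2) * cos c :> R.
  by rewrite expr2 ler_pM.
rewrite cos4 => h; rewrite mulrA.
have : 1 / 2 * (t / 2) <= cos (t / 2) * cos c * (t / 2) by rewrite ler_pM2r; lra.
lra.
Qed.

Lemma sinpi_ge (R : realType) (z : R) : `|z| <= 1 / 2 -> `|z| <= `|sin (pi * z)|.
Proof.
have pi2 := @pi_ge2 R.
wlog z0 : z / 0 <= z => [hw|].
  have [/hw//|/ltW z0] := leP 0 z.
  by move: (hw (- z)); rewrite mulrN sinN !normrN; apply; lra.
rewrite (ger0_norm z0) => z2; apply: le_trans (ler_norm _).
apply: le_trans (@sin_ge_half R (pi * z) _); last first.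
  by rewrite mulr_ge0 ?pi_ge0//= ler_pM2l ?pi_gt0//; lra.
nra.
Qed.

(** A stand-in for the distance to the nearest integer: its reciprocal splits as [1/z + 1/(1-z)],
    which treats both endpoints at once. *)
Lemma sinpi_geM (R : realType) (z : R) : 0 <= z <= 1 -> z * (1 - z) <= `|sin (pi * z)|.
Proof.
move=> /andP[z0 z1].
wlog zl : z z0 z1 / z <= 1 / 2 => [hw|].
  have [/hw->//|zg] := leP z (1 / 2).
  have := hw (1 - z) ltac:(lra) ltac:(lra) ltac:(lra); rewrite subKr mulrC.
  by rewrite (mulrBr pi) mulr1 (sinB pi) sinpi cospi mul0r sub0r mulN1r opprK.
apply: le_trans (@sinpi_ge R z _); rewrite ger0_norm//; nra.
Qed.

Lemma sinpi_norm_int (R : realType) (z : R) (n : nat) :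
  `|sin (pi * (z + n%:R))| = `|sin (pi * z)|.
Proof.
elim: n => [|n ih]; first by rewrite addr0.
by rewrite -natr1 addrA mulrDr mulr1 sinDpi normrN.
Qed.

(** Pairs are grouped by their difference [h] because, for fixed [h], the phase difference of a
    quadratic is linear in [v]. *)
Lemma triangular_reindex (V : zmodType) (F : nat -> nat -> V) (L : nat) :
  \sum_(0 <= k < L) \sum_(0 <= v < k) F k v =
  \sum_(1 <= h < L) \sum_(0 <= v < L - h) F (v + h)%N v.
Proof.
elim: L => [|L ih]; first by rewrite !big_geq.
rewrite big_nat_recr//= ih.
have [->|L0] := posnP L; first by rewrite !big_geq// addr0.
rewrite [RHS]big_nat_recr//= subSnn big_nat1 add0n.
have -> : \sum_(1 <= h < L) \sum_(0 <= v < L.+1 - h) F (v + h)%N v =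
  \sum_(1 <= h < L) (\sum_(0 <= v < L - h) F (v + h)%N v + F L (L - h)%N).
  apply: eq_big_nat => h /andP[h1 hL].
  by rewrite subSn ?(ltnW hL)// big_nat_recr//= subnK// ltnW.
rewrite big_split/= -addrA; congr (_ + _).
rewrite big_ltn// [LHS]addrC; congr (_ + _).
rewrite [LHS]big_nat_rev/=; apply: eq_big_nat => h /andP[h1 hL].
by congr (F _ _); rewrite add1n subSS.
Qed.

Lemma sqr_norm_trig_sum (R : realType) (f : nat -> R) (L : nat) :
  (\sum_(0 <= u < L) cos (f u)) ^+ 2 + (\sum_(0 <= u < L) sin (f u)) ^+ 2 =
  L%:R + 2 * \sum_(0 <= k < L) \sum_(0 <= v < k) cos (f k - f v).
Proof.
elim: L => [|L ih]; first by rewrite !big_geq// expr0n/=; lra.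
rewrite !(big_nat_recr L)//= mulrDr -[L.+1%:R]natr1 addrACA -ih.
have -> : \sum_(0 <= v < L) cos (f L - f v) =
  cos (f L) * \sum_(0 <= v < L) cos (f v) + sin (f L) * \sum_(0 <= v < L) sin (f v).
  by rewrite !mulr_sumr -big_split/=; apply: eq_bigr => v _; rewrite cosB.
by have := cos2Dsin2 (f L); lra.
Qed.

(** Multiplied by [sin c], the sum telescopes through [2 cos x sin c = sin (x + c) - sin (x - c)].
    The product form also covers [sin c = 0]. *)
Lemma arith_cos_sum (R : realType) (a c : R) (K : nat) :
  `|\sum_(0 <= v < K) cos (a + c * 2 * v%:R)| * `|sin c| <= 1.
Proof.
rewrite -normrM.
have -> : (\sum_(0 <= v < K) cos (a + c * 2 * v%:R)) * sin c =
   (sin (a - c + c * 2 * K%:R) - sin (a - c)) / 2.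
  elim: K => [|K ih]; first by rewrite big_geq// mulr0 addr0; lra.
  rewrite big_nat_recr//= mulrDl ih -[K.+1%:R]natr1.
  have -> : a - c + c * 2 * (K%:R + 1) = a + c * 2 * K%:R + c by ring.
  have -> : a - c + c * 2 * K%:R = a + c * 2 * K%:R - c by ring.
  rewrite (sinD (a + c * 2 * K%:R) c) (sinB (a + c * 2 * K%:R) c); lra.
have h1 := @sin_max R (a - c + c * 2 * K%:R); have h2 := @sin_max R (a - c).
move: h1 h2; rewrite !ler_norml => /andP[? ?] /andP[? ?]; lra.
Qed.

(** [B h] is the modulus of the sum with difference [h]; only its two bounds matter later, so it
    stays abstract. These bounds involve neither [b], [c] nor [L], and this uniformity over [L <= M]
    is what Abel summation requires. *)
Lemma weyl_differencing (R : realType) (M L : nat) (y b c : R) : (L <= M)%N ->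
  exists B : nat -> R,
  [/\ forall h, 0 <= B h <= M%:R,
      forall h, B h * `|sin (pi * (y * h%:R))| <= 1 &
      (\sum_(0 <= u < L) cos (pi * y * u%:R ^+ 2 + b * u%:R + c)) ^+ 2 +
      (\sum_(0 <= u < L) sin (pi * y * u%:R ^+ 2 + b * u%:R + c)) ^+ 2
        <= M%:R + 2 * \sum_(1 <= h < M) B h].
Proof.
move=> LM.
pose f u := pi * y * u%:R ^+ 2 + b * u%:R + c.
exists (fun h => `|\sum_(0 <= v < L - h) cos (f (v + h)%N - f v)|); split.
- move=> h; rewrite normr_ge0/=.
  apply: (le_trans (ler_norm_sum _ _ _)).
  apply: (@le_trans _ _ (\sum_(0 <= v < L - h) 1)).
    by apply: ler_sum => i _; exact: cos_max.
  rewrite big_const_nat iter_addr_0 subn0 ler_nat; lia.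
- move=> h.
  have := @arith_cos_sum R (pi * y * h%:R ^+ 2 + b * h%:R) (pi * (y * h%:R)) (L - h).
  congr (`|_| * _ <= _); apply: eq_bigr => v _; congr (cos _).
  by rewrite /f natrD; ring.
rewrite sqr_norm_trig_sum triangular_reindex lerD// ?ler_nat// ler_pM2l//.
apply: (@le_trans _ _ (\sum_(1 <= h < L) `|\sum_(0 <= v < L - h) cos (f (v + h)%N - f v)|)).
  by apply: ler_sum => i _; exact: ler_norm.
have [L1|L1] := leqP L 1.
  by rewrite (big_geq L1) sumr_ge0.
by rewrite (big_cat_nat _ LM)/= ?(ltnW L1)// lerDl sumr_ge0.
Qed.

(** * Sums of powers and Dirichlet approximation *)

Lemma eq_ler (R : numDomainType) (x y : R) : x = y -> x <= y.
Proof. by move->. Qed.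

Lemma powRD_gt0 (R : realType) (x r t : R) : 0 < x -> x `^ (r + t) = x `^ r * x `^ t.
Proof. by move=> x0; rewrite powRD// (gt_eqF x0) implybT. Qed.

Lemma powRB_gt0 (R : realType) (x r t : R) : 0 < x -> x `^ (r - t) = x `^ r / x `^ t.
Proof. by move=> x0; rewrite powRB// (gt_eqF x0) implybT. Qed.

Lemma powRV (R : realType) (x r : R) : 0 <= x -> x^-1 `^ r = (x `^ r)^-1.
Proof. by move=> x0; rewrite -[x^-1]powR_inv1// -powRrM mulN1r powRN. Qed.

Lemma powR_le_tangent (R : realType) (b x : R) : 0 < b <= 1 -> 0 <= x ->
  x `^ b <= 1 + b * (x - 1).
Proof.
move=> /andP[b0 b1]; rewrite le_eqVlt => /orP[/eqP <-|x0].
  by rewrite powR0 ?gt_eqF//; lra.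
set w := 1 + b * (x - 1).
have w0 : 0 < w by rewrite /w; nra.
have ln_le (z : R) : 0 < z -> ln z <= z - 1.
  by move=> z0; have := @le_ln1Dx R (z - 1) ltac:(lra); rewrite addrC subrK.
(* Weighted by [b] and [1 - b], the right-hand sides of [h1] and [h2] cancel, since
   [b x + (1 - b) = w]. *)
have h1 := ln_le (x / w) ltac:(exact: divr_gt0).
have h2 := ln_le (1 / w) ltac:(exact: divr_gt0).
move: h1 h2; rewrite !ln_div ?posrE// ln1 => h1 h2.
have h3 : b * (x / w - 1) + (1 - b) * (1 / w - 1) = 0.
  by rewrite /w; field; rewrite gt_eqF.
have h4 : b * ln x <= ln w by nra.
by rewrite /powR gt_eqF// -[leRHS]lnK ?posrE// ler_expR.
Qed.

Lemma powRN_ge_tangent (R : realType) (c x : R) : 0 <= c -> 0 < x ->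
  1 + c * (1 - x) <= x `^ (- c).
Proof.
move=> c0 x0; rewrite /powR gt_eqF//.
apply: le_trans (expR_ge1Dx _).
have := @le_ln1Dx R (x - 1) ltac:(lra); rewrite addrC subrK; nra.
Qed.

(** Comparison with the integral of [x^(-a)], carried out by induction: the step from [n] to [n + 1]
    is the tangent inequality at [n / (n + 1)]. *)
Lemma sum_powRN_le (R : realType) (a : R) (n : nat) : 0 <= a < 1 ->
  \sum_(1 <= k < n.+1) k%:R `^ (- a) <= n%:R `^ (1 - a) / (1 - a).
Proof.
move=> /andP[a0 a1]; elim: n => [|n ih].
  by rewrite big_geq// divr_ge0 ?powR_ge0//; lra.
rewrite big_nat_recr//=; apply: (le_trans (lerD ih (lexx _))).
have m0 : 0 < n.+1%:R :> R by rewrite ltr0n.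
have := @powR_le_tangent R (1 - a) (n%:R / n.+1%:R) ltac:(lra) ltac:(exact: divr_ge0).
have -> : n%:R / n.+1%:R - 1 = - (n.+1%:R)^-1 :> R.
  by rewrite -[n.+1%:R]natr1; field; rewrite natr1 gt_eqF.
have P0 : 0 < n.+1%:R `^ (1 - a) :> R by exact: powR_gt0.
rewrite powRM// ?invr_ge0//.
rewrite powRV ?ler0n//.
rewrite ler_pdivrMr// => h.
have -> : n.+1%:R `^ (- a) = n.+1%:R `^ (1 - a) / n.+1%:R :> R.
  by rewrite [in LHS](_ : - a = (1 - a) - 1); [rewrite powRB_gt0// powRr1|ring].
rewrite -lerBrDl -mulrBl ler_pdivlMr; last by lra.
by move: h; move: (n.+1%:R)^-1 => i h; nra.
Qed.

Lemma sum_powR_tail_le (R : realType) (c : R) (K L : nat) : 0 < c -> (0 < K)%N ->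
  (K <= L)%N -> \sum_(K.+1 <= k < L.+1) k%:R `^ (- (1 + c)) <= K%:R `^ (- c) / c.
Proof.
move=> c0 K0 KL.
(* The induction needs the telescoping form; the term in [L] is then dropped. *)
suff : \sum_(K.+1 <= k < L.+1) k%:R `^ (- (1 + c)) <=
    K%:R `^ (- c) / c - L%:R `^ (- c) / c.
  move/le_trans; apply; rewrite lerBlDr lerDl divr_ge0 ?powR_ge0//; exact: ltW.
elim: L KL => [|L ih]; first by lia.
rewrite leq_eqVlt => /orP[/eqP <-|]; first by rewrite big_geq// subrr.
rewrite ltnS => KL; rewrite big_nat_recr//=; apply: (le_trans (lerD (ih KL) (lexx _))).
have m0 : 0 < L.+1%:R :> R by rewrite ltr0n.
have L0 : 0 < L%:R :> R by rewrite ltr0n; lia.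
have := @powRN_ge_tangent R c (L%:R / L.+1%:R) ltac:(lra) ltac:(exact: divr_gt0).
have -> : 1 - L%:R / L.+1%:R = (L.+1%:R)^-1 :> R.
  by rewrite -[X in X - _](divff (lt0r_neq0 m0)) -mulrBl -natr1 addrAC subrr add0r mul1r natr1.
have P0 : 0 < L.+1%:R `^ (- c) :> R by exact: powR_gt0.
rewrite powRM ?invr_ge0//; try exact: ltW.
rewrite powRV ?ler0n//.
rewrite ler_pdivlMr// => h.
have -> : L.+1%:R `^ (- (1 + c)) = L.+1%:R `^ (- c) / L.+1%:R :> R.
  by rewrite (_ : - (1 + c) = - c - 1); [rewrite powRB_gt0// powRr1|ring].
have : L.+1%:R `^ (- c) / L.+1%:R <= (L%:R `^ (- c) - L.+1%:R `^ (- c)) / c.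
  by rewrite ler_pdivlMr//; move: h; move: (L.+1%:R)^-1 => i h; nra.
move=> h3; apply: (le_trans (lerD (lexx _) h3)); rewrite mulrBl; lra.
Qed.

(** Pigeonhole: the fractional parts of [k y] for [0 <= k <= n] fall into [n] boxes of length [1/n].
    Since [y >= 0], the numerator is a natural number. *)
Lemma dirichlet_approx (R : realType) (y : R) (n : nat) : 0 <= y -> (0 < n)%N ->
  exists q a : nat, [/\ (0 < q <= n)%N, coprime a q & `|q%:R * y - a%:R| * n%:R < 1].
Proof.
move=> y0 n0.
have n0R : 0 < n%:R :> R by rewrite ltr0n.
pose t (k : nat) := Num.truncn (k%:R * y).
pose fr (k : nat) := k%:R * y - (t k)%:R.
have frP k : 0 <= fr k < 1.
  have /truncn_itv : 0 <= k%:R * y by rewrite mulr_ge0.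
  rewrite /fr /t -natr1; lra.
pose bx k := Num.truncn (n%:R * fr k).
have bxP k : (bx k)%:R <= n%:R * fr k < (bx k)%:R + 1.
  have /andP[f0 f1] := frP k.
  have /truncn_itv : 0 <= n%:R * fr k by rewrite mulr_ge0// ltW.
  by rewrite natr1.
have bxn k : (bx k < n)%N.
  rewrite -(ltr_nat R); have /andP[? ?] := bxP k; have /andP[? ?] := frP k; nra.
have : ~~ injectiveb (fun i : 'I_n.+1 => Ordinal (bxn i)).
  by apply/negP => /injectiveP/leq_card; rewrite !card_ord ltnn.
move=> /injectivePn[i [j ij [/= eb]]].
wlog ltij : i j ij eb / (i < j)%N => [hw|].
  have := ij; rewrite -(inj_eq val_inj)/= neq_ltn => /orP[|] h; first exact: (hw i j).
  by apply: (hw j i) => //; rewrite eq_sym.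
pose q := (j - i)%N.
have tij : (t i <= t j)%N.
  by apply: le_truncn; rewrite ler_wpM2r// ler_nat ltnW.
pose a := (t j - t i)%N.
have q0 : (0 < q)%N by rewrite subn_gt0.
have qn : (q <= n)%N by have := ltn_ord j; rewrite /q; lia.
have hqa : `|q%:R * y - a%:R| * n%:R < 1.
  rewrite natrB ?(ltnW ltij)// natrB//.
  have -> : (j%:R - i%:R) * y - ((t j)%:R - (t i)%:R) = fr j - fr i.
    by rewrite /fr; ring.
  rewrite -[n%:R]ger0_norm// -normrM ltr_norml.
  move: (bxP i) (bxP j); rewrite eb => /andP[? ?] /andP[? ?]; nra.
(* Cancelling [g] gives coprimality, and divides [|q y - a|] by [g], so the approximation
   survives. *)
pose g := gcdn a q.
have g0 : (0 < g)%N by rewrite gcdn_gt0 q0 orbT.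
have gq : (q %/ g * g = q)%N by rewrite divnK// dvdn_gcdr.
have ga : (a %/ g * g = a)%N by rewrite divnK// dvdn_gcdl.
exists (q %/ g)%N, (a %/ g)%N; split.
- by rewrite divn_gt0// dvdn_leq ?dvdn_gcdr//= (leq_trans (leq_div _ _)).
- by rewrite /coprime -(eqn_pmul2r g0) muln_gcdl gq ga mul1n.
apply: le_lt_trans hqa; rewrite ler_wpM2r ?ler0n//.
rewrite -{2}gq -{2}ga !natrM mulrAC -mulrBl normrM ler_peMr//.
by rewrite normr_nat ler1n.
Qed.

Lemma big_nat_mul (V : nmodType) (F : nat -> V) (n q : nat) :
  \sum_(0 <= h < n * q) F h = \sum_(0 <= k < n) \sum_(0 <= c < q) F (k * q + c)%N.
Proof.
elim: n => [|n ih]; first by rewrite mul0n !big_geq.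
rewrite big_nat_recr//= -ih mulSn addnC (big_cat_nat (n := n * q))//= ?leq_addr//.
congr (_ + _); rewrite -{1}[(n * q)%N]add0n big_addn addKn.
by apply: eq_bigr => c _; rewrite addnC.
Qed.

Lemma big_mulmod (V : nmodType) (F : nat -> V) (a q : nat) : coprime a q ->
  \sum_(0 <= c < q) F ((c * a) %% q)%N = \sum_(0 <= c < q) F c.
Proof.
case: q => [|q] co; first by rewrite !big_geq.
pose p (i : 'I_q.+1) : 'I_q.+1 := inord ((i * a) %% q.+1)%N.
have pE i : p i = ((i * a) %% q.+1)%N :> nat by rewrite inordK// ltn_pmod.
rewrite !big_mkord [RHS](reindex_inj (h := p)).
  by apply: eq_bigr => i _; rewrite pE.
move=> i j /(congr1 val); rewrite /= !pE => /eqP h.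
apply: val_inj => /=; move: h.
wlog ij : i j / (j <= i)%N => [hw|].
  by have [/hw//|/ltnW/hw {}hw] := leqP j i; rewrite eq_sym => /hw.
rewrite eqn_mod_dvd ?leq_mul2r ?ij ?orbT// -mulnBl Gauss_dvdl 1?coprime_sym// => d.
apply/eqP; rewrite eqn_leq ij andbT -subn_eq0.
have : (i - j < q.+1)%N by rewrite (leq_ltn_trans (leq_subr _ _)).
by case: (i - j)%N d => // m /dvdn_leq; lia.
Qed.

(** * The differenced sum near a rational number *)

Section rational_approximation.
Context (R : realType) (M q a : nat) (y : R).
Hypotheses (M0 : (0 < M)%N) (q0 : (0 < q)%N) (q2M : (q <= 2 * M)%N).
Hypotheses (coaq : coprime a q) (aq : `|q%:R * y - a%:R| * (2 * M)%:R < 1).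

Let be := y - a%:R / q%:R.
Let qR0 : 0 < q%:R :> R. Proof. by rewrite ltr0n. Qed.
Let MR0 : 0 < M%:R :> R. Proof. by rewrite ltr0n. Qed.

Let yE : y = a%:R / q%:R + be. Proof. by rewrite /be; ring. Qed.

(** This is why denominators up to [2 M] are allowed rather than [M]: [h y] then stays within half
    the spacing [1/q] of [h a / q] for every difference [h <= M]. *)
Let beta_scaled_le h : (h <= M)%N -> `|h%:R * be| <= (2 * q%:R)^-1.
Proof.
move=> hM; rewrite normrM normr_nat.
have -> : `|be| = `|q%:R * y - a%:R| / q%:R.
  by rewrite -[X in _ / X]gtr0_norm// -normf_div; congr `|_|; rewrite /be; field; rewrite gt_eqF.
rewrite invfM mulrA ler_pM2r ?invr_gt0//.
have : h%:R <= M%:R :> R by rewrite ler_nat.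
move: aq; rewrite natrM; have := normr_ge0 (q%:R * y - a%:R).
move: `|_| => u u0 h1 h2; nra.
Qed.

(** Modulo 1, [h y] is [z], which differs from [c / q] by at most [1 / (2 q)]. As [1 <= c <= q - 1],
    this at most halves the distances to 0 and to 1. *)
Lemma sin_noncentral h : (h <= M)%N -> (h * a %% q != 0)%N ->
  let c : R := (h * a %% q)%:R in
  `|sin (pi * (y * h%:R))|^-1 <= 2 * q%:R / c + 2 * q%:R / (q%:R - c)
  /\ 0 < `|sin (pi * (y * h%:R))|.
Proof.
move=> hM hc c.
have c1 : 1 <= c by rewrite /c ler1n lt0n.
have cq : c <= q%:R - 1.
  by rewrite lerBrDr natr1 ler_nat ltn_pmod.
set z := c / q%:R + h%:R * be.
have -> : `|sin (pi * (y * h%:R))| = `|sin (pi * z)|.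
  rewrite -(sinpi_norm_int z (h * a %/ q)); congr `|sin (_ * _)|.
  rewrite {1}yE mulrDl (mulrC be) /z addrAC; congr (_ + _).
  rewrite mulrAC -natrM (mulnC a) {1}(divn_eq (h * a) q) natrD natrM /c.
  by field; rewrite gt_eqF.
have := beta_scaled_le hM; rewrite ler_norml => /andP[b1 b2].
have i0 : 0 < q%:R^-1 :> R by rewrite invr_gt0.
have qi : q%:R * q%:R^-1 = 1 :> R by rewrite divff// gt_eqF.
have e1 : (2 * q%:R)^-1 = q%:R^-1 / 2 :> R by rewrite invfM mulrC.
rewrite e1 in b1 b2.
have z1 : c / (2 * q%:R) <= z by rewrite invfM /z; nra.
have z2 : (q%:R - c) / (2 * q%:R) <= 1 - z by rewrite invfM /z; nra.
have p1 : 0 < c / (2 * q%:R) by rewrite divr_gt0//; lra.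
have p2 : 0 < (q%:R - c) / (2 * q%:R) by rewrite divr_gt0//; lra.
have sz := @sinpi_geM R z ltac:(lra).
have z0 : 0 < z by lra.
have z10 : 0 < 1 - z by lra.
have zz : 0 < z * (1 - z) by exact: mulr_gt0.
have s0 := lt_le_trans zz sz.
split=> //.
apply: (@le_trans _ _ (z * (1 - z))^-1); first by rewrite lef_pV2 ?posrE.
have -> : (z * (1 - z))^-1 = z^-1 + (1 - z)^-1.
  by field; rewrite !gt_eqF.
have inv2 (u v : R) : 0 < u / v -> v / u = (u / v)^-1 by rewrite invf_div.
by rewrite lerD// inv2// lef_pV2 ?posrE.
Qed.

(** For [h = k q] the rational part of [h y] is the integer [k a], so only the error [k q be] is
    left. *)
Lemma sin_central k : (k * q <= M)%N ->
  (k * q)%:R * `|be| <= `|sin (pi * (y * (k * q)%:R))|.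
Proof.
move=> kM; have h := beta_scaled_le kM.
have -> : `|sin (pi * (y * (k * q)%:R))| = `|sin (pi * ((k * q)%:R * be))|.
  rewrite -(sinpi_norm_int ((k * q)%:R * be) (k * a)); congr `|sin (_ * _)|.
  by rewrite {1}yE !natrM; field; rewrite gt_eqF.
rewrite -[X in X * _]normr_nat -normrM; apply: sinpi_ge.
apply: (le_trans h); rewrite invfM mul1r ler_piMr// invf_le1// ler1n//.
Qed.

Context (B : nat -> R).
Hypotheses (BM : forall h, 0 <= B h <= M%:R).
Hypotheses (Bs : forall h, B h * `|sin (pi * (y * h%:R))| <= 1).

Let X := Num.max 1 (M%:R ^+ 2 * `|be|).

(** Full decay [X^(-1)] would leave a harmonic sum over [k]. Using the decay bound only to the power
    [3/4] leaves [k^(-3/4)], whose sum is [4 (M/q)^(1/4)] at most. *)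
Lemma sum_central : \sum_(1 <= k < (M %/ q).+1) B (k * q)%N <=
  4 * (M%:R ^+ 2 / q%:R) * X `^ (- (3 / 4)).
Proof.
have X1 : 1 <= X by rewrite le_max lexx.
have X0 : 0 < X by lra.
have P0 : 0 < X `^ (3 / 4) by exact: powR_gt0.
rewrite powRN ler_pdivlMr// mulr_suml.
pose D : R := M%:R * (M%:R / q%:R) `^ (3 / 4).
have Mq0 : 0 < M%:R / q%:R :> R by exact: divr_gt0.
have step k : (1 <= k < (M %/ q).+1)%N ->
    B (k * q)%N * X `^ (3 / 4) <= D * k%:R `^ (- (3 / 4)).
  move=> /andP[k1 kn].
  have kM : (k * q <= M)%N by move: kn; rewrite ltnS leq_divRL.
  have k0 : 0 < k%:R :> R by rewrite ltr0n.
  have kq0 : 0 < (k * q)%:R :> R by rewrite ltr0n muln_gt0 k1.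
  have /andP[b0 bM] := BM (k * q)%N.
  have BX : B (k * q)%N * X <= M%:R * (M%:R / (k * q)%:R).
    rewrite mulrA ler_pdivlMr// /X.
    have kMR : (k * q)%:R <= M%:R :> R by rewrite ler_nat.
    rewrite /Num.max; case: ifP => _; last by rewrite mulr1 ler_pM// ltW.
    have h1 := le_trans (ler_wpM2l b0 (sin_central kM)) (Bs (k * q)).
    rewrite -expr2; have := ler_wpM2l (sqr_ge0 (M%:R : R)) h1; rewrite mulr1.
    by apply: le_trans; apply: eq_ler => //; ring.
  (* Interpolate between [B <= M] and [B X <= M^2 / (k q)]. *)
  have -> : B (k * q)%N * X `^ (3 / 4) =
      B (k * q)%N `^ (1 / 4) * (B (k * q)%N * X) `^ (3 / 4).
    rewrite powRM//; last exact: ltW.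
    rewrite mulrA -powRD; last by apply/implyP; lra.
    by rewrite (_ : 1 / 4 + 3 / 4 = 1); [rewrite powRr1|lra].
  have -> : D * k%:R `^ (- (3 / 4)) =
      M%:R `^ (1 / 4) * (M%:R * (M%:R / (k * q)%:R)) `^ (3 / 4).
    rewrite (powRM _ (ltW MR0)) ?divr_ge0 ?ler0n//.
    rewrite mulrA -powRD; last by apply/implyP; lra.
    rewrite (_ : 1 / 4 + 3 / 4 = 1); last lra.
    rewrite powRr1 ?ler0n// /D -mulrA; congr (_ * _).
    rewrite natrM invfM (mulrC (k%:R^-1)) mulrA [RHS]powRM ?divr_ge0 ?invr_ge0 ?ler0n//.
    by rewrite (powRV _ (ltW k0)) powRN.
  rewrite ler_pM ?powR_ge0// ge0_ler_powR ?nnegrE ?divr_ge0 ?mulr_ge0 ?invr_ge0 ?ler0n//; try lra.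
rewrite big_nat_cond.
apply: (@le_trans _ _ (\sum_(1 <= k < (M %/ q).+1 | (1 <= k < (M %/ q).+1)%N && true)
   D * k%:R `^ (- (3 / 4)))).
  by apply: ler_sum => k; rewrite andbT => /step.
rewrite -big_nat_cond -mulr_sumr.
have D0 : 0 <= D by rewrite mulr_ge0 ?powR_ge0// ltW.
apply: (le_trans (ler_wpM2l D0 (@sum_powRN_le R (3 / 4) (M %/ q) ltac:(lra)))).
have nMq : (M %/ q)%:R <= M%:R / q%:R :> R.
  by rewrite ler_pdivlMr// -natrM ler_nat leq_trunc_div.
have h1 : (M %/ q)%:R `^ (1 - 3 / 4) <= (M%:R / q%:R) `^ (1 - 3 / 4) :> R.
  by rewrite ge0_ler_powR ?nnegrE ?ler0n ?(ltW Mq0)//; lra.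
rewrite (_ : (1 - 3 / 4)^-1 = 4 :> R); last first.
  by rewrite (_ : 1 - 3 / 4 = 4^-1 :> R) ?invrK//; lra.
apply: (@le_trans _ _ (D * ((M%:R / q%:R) `^ (1 - 3 / 4) * 4))).
  by rewrite ler_wpM2l// ler_pM2r.
rewrite /D -mulrA [X in _ * X <= _]mulrA -powRD; last first.
  by apply/implyP => _; rewrite gt_eqF.
rewrite (_ : 3 / 4 + (1 - 3 / 4) = 1 :> R) ?powRr1 ?(ltW Mq0)//; last lra.
by apply: eq_ler => //; ring.
Qed.

(** The reflection of [c] into [q - c] identifies the two halves. The harmonic sum is bounded by
    [q^eps / eps] in place of a logarithm, so that only powers occur. *)
Lemma sum_noncentral (eps : R) : 0 < eps < 1 ->
  \sum_(1 <= c < q) (2 * q%:R / c%:R + 2 * q%:R / (q%:R - c%:R)) <=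
   4 * q%:R * (q%:R `^ eps / eps) :> R.
Proof.
move=> /andP[e0 e1].
rewrite big_split/=.
have -> : \sum_(1 <= c < q) 2 * q%:R / (q%:R - c%:R) = \sum_(1 <= c < q) 2 * q%:R / c%:R :> R.
  rewrite [RHS]big_nat_rev/=; apply: eq_big_nat => c /andP[c1 cq].
  by rewrite add1n subSS natrB// ltnW.
rewrite -mulr_sumr.
have : \sum_(1 <= c < q) c%:R^-1 <= q%:R `^ eps / eps :> R.
  have := @sum_powRN_le R (1 - eps) q ltac:(lra); rewrite subKr; apply: le_trans.
  apply: (@le_trans _ _ (\sum_(1 <= c < q) c%:R `^ (- (1 - eps)))); last first.
    by rewrite [leRHS]big_nat_recr//= lerDl powR_ge0.
  rewrite big_nat_cond [leRHS]big_nat_cond; apply: ler_sum => c /andP[/andP[c1 cq] _].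
  rewrite -(powR_inv1 (ler0n _ _)); apply: ler_powR; [by rewrite ler1n|lra].
have : 0 < 2 * q%:R :> R by rewrite mulr_gt0.
move: (\sum_(1 <= c < q) _) (_ / eps) => u v h1 h2; nra.
Qed.

(** Write [h = k q + c]. The terms with [c = 0] form the central sum; for fixed [k] the others have
    residues [h a] running once over the nonzero classes modulo [q]. *)
Lemma sum_differenced_le (eps : R) : 0 < eps < 1 -> \sum_(1 <= h < M) B h <=
  24 / eps * (M%:R * M%:R `^ eps) + 4 * (M%:R ^+ 2 / q%:R) * X `^ (- (3 / 4)).
Proof.
move=> /andP[e0 e1].
(* Extension by zero, so that the range of [h] can be padded to whole blocks of length [q]. *)
pose f h := if (1 <= h < M)%N then B h else 0.
pose G (c : nat) : R := 2 * q%:R / c%:R + 2 * q%:R / (q%:R - c%:R).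
have f0 h : 0 <= f h by rewrite /f; case: ifP => // _; have /andP[] := BM h.
have fB h : f h <= B h by rewrite /f; case: ifP => // _; have /andP[] := BM h.
have Mn : (M <= (M %/ q).+1 * q)%N.
  by rewrite {1}(divn_eq M q) mulSn addnC leq_add2r ltnW// ltn_pmod.
have -> : \sum_(1 <= h < M) B h = \sum_(0 <= h < M) f h.
  rewrite [RHS]big_ltn// {1}/f/= add0r; apply: eq_big_nat => h hM.
  by rewrite /f hM.
apply: (@le_trans _ _ (\sum_(0 <= h < (M %/ q).+1 * q) f h)).
  by rewrite [leRHS](big_cat_nat _ Mn)//= lerDl sumr_ge0.
rewrite big_nat_mul.
apply: (@le_trans _ _ (\sum_(0 <= k < (M %/ q).+1)
   (f (k * q)%N + 4 * q%:R * (q%:R `^ eps / eps)))).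
  apply: ler_sum => k _; rewrite big_ltn// addn0 lerD2l.
  apply: le_trans (@sum_noncentral eps ltac:(lra)).
  (* [big_mulmod] permutes all residues including 0, so the summand is replaced by 0 there; for
     [0 < c < q] coprimality keeps [c a] nonzero modulo [q]. *)
  have E : \sum_(1 <= c < q) G c = \sum_(1 <= c < q) G ((c * a) %% q)%N.
    have := @big_mulmod R (fun c => if c == 0%N then 0 else G c) a q coaq.
    rewrite !(big_ltn q0) mul0n mod0n/= !add0r => h; apply/esym.
    rewrite (@eq_big_nat _ _ _ _ _ _ (fun c => if (c * a %% q == 0)%N then 0 else G (c * a %% q)%N)).
      rewrite h; apply: eq_big_nat => -[|c]//.
    move=> c /andP[c1 cq]; case: ifP => // /eqP/eqP.
    rewrite -/(dvdn q _) Gauss_dvdl 1?coprime_sym// => /dvdn_leq -/(_ c1).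
    by rewrite leqNgt cq.
  rewrite -/(\sum_(1 <= c < q) G c) E big_nat_cond [leRHS]big_nat_cond.
  apply: ler_sum => c /andP[/andP[c1 cq] _].
  have cma : (c * a %% q != 0)%N.
    apply/negP; rewrite -/(dvdn q _) Gauss_dvdl 1?coprime_sym// => /dvdn_leq -/(_ c1).
    by rewrite leqNgt cq.
  have ckE : ((k * q + c) * a %% q = c * a %% q)%N.
    by rewrite mulnDl mulnAC modnMDl.
  rewrite /f; case: ifP => [/andP[_ hM]|_]; last first.
    rewrite /G addr_ge0// divr_ge0 ?mulr_ge0 ?ler0n//.
    by rewrite subr_ge0 ler_nat ltnW// ltn_pmod.
  have := @sin_noncentral (k * q + c) (ltnW hM); rewrite ckE => /(_ cma)[h1 s0].
  by apply: le_trans h1; rewrite -[leRHS]mul1r ler_pdivlMr.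
rewrite big_split/= [leRHS]addrC lerD//.
  rewrite big_ltn// mul0n {1}/f/= add0r.
  by apply: le_trans sum_central; apply: ler_sum => k _.
rewrite big_const_nat subn0 iter_addr_0 -mulr_natr.
have qe : q%:R `^ eps <= 2 * M%:R `^ eps :> R.
  apply: (@le_trans _ _ ((2 * M)%:R `^ eps)).
    by rewrite ge0_ler_powR ?nnegrE ?ler0n ?ler_nat// ltW.
  rewrite natrM powRM ?ler0n// ler_wpM2r ?powR_ge0//.
  by rewrite ler1_powR//; lra.
(* The left side is at most [M + q], and [q <= 2 M]. Together with [qe] this makes the constant
   [24 = 4 * 3 * 2]. *)
have nq : q%:R * (M %/ q).+1%:R <= 3 * M%:R :> R.
  rewrite -!natrM ler_nat mulnC mulSn.
  have := leq_trunc_div M q; lia.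
have P0 := powR_ge0 (q%:R : R) eps.
have n0 : 0 <= q%:R * (M %/ q).+1%:R :> R by rewrite mulr_ge0.
have h := ler_pM n0 P0 nq qe.
have i0 : 0 < 4 / eps by rewrite divr_gt0.
have := ler_wpM2l (ltW i0) h.
rewrite (_ : 4 / eps * (3 * M%:R * (2 * M%:R `^ eps)) =
  24 / eps * (M%:R * M%:R `^ eps)); last by ring.
by apply: le_trans; apply: eq_ler; ring.
Qed.

End rational_approximation.

(** * Complex exponential sums *)

Section cmod_theory.
Context (R : realType).
Implicit Types z w : R[i].

Lemma cmodE z : cmod z = ComplexField.Normc.normc z. Proof. by case: z. Qed.

Lemma cmod_ge0 z : 0 <= cmod z. Proof. exact: sqrtr_ge0. Qed.

Lemma cmodM z w : cmod (z * w) = cmod z * cmod w.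
Proof. by rewrite !cmodE ComplexField.Normc.normcM. Qed.

Lemma cmodD z w : cmod (z + w) <= cmod z + cmod w.
Proof. by rewrite !cmodE; exact: le_normcD. Qed.

Lemma cmod0 : cmod (0 : R[i]) = 0.
Proof. by rewrite cmodE ComplexField.Normc.normc0. Qed.

Lemma cmodN z : cmod (- z) = cmod z.
Proof. by rewrite !cmodE normcN. Qed.

Lemma cmodC (r : R) : cmod r%:C%C = `|r|.
Proof. by rewrite /cmod/= expr0n/= addr0 sqrtr_sqr. Qed.

Lemma sqr_cmod z : cmod z ^+ 2 = complex.Re z ^+ 2 + complex.Im z ^+ 2.
Proof. by rewrite sqr_sqrtr// addr_ge0 ?sqr_ge0. Qed.

Lemma cmod_sum (I : Type) (r : seq I) (P : pred I) (F : I -> R[i]) :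
  cmod (\sum_(i <- r | P i) F i) <= \sum_(i <- r | P i) cmod (F i).
Proof.
elim/big_ind2 : _ => //; first by rewrite cmod0.
by move=> x1 x2 y1 y2 h1 h2; apply: (le_trans (cmodD _ _)); rewrite lerD.
Qed.

Lemma Re_sum (I : Type) (r : seq I) (P : pred I) (F : I -> R[i]) :
  complex.Re (\sum_(i <- r | P i) F i) = \sum_(i <- r | P i) complex.Re (F i).
Proof. by apply: (big_morph _ _ (erefl : complex.Re (0 : R[i]) = 0)) => -[? ?] []. Qed.

Lemma Im_sum (I : Type) (r : seq I) (P : pred I) (F : I -> R[i]) :
  complex.Im (\sum_(i <- r | P i) F i) = \sum_(i <- r | P i) complex.Im (F i).
Proof. by apply: (big_morph _ _ (erefl : complex.Im (0 : R[i]) = 0)) => -[? ?] []. Qed.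

End cmod_theory.

Definition cexpN (R : realType) (t : R) : R[i] := (cos t -i* sin t)%C.

Lemma cmod_cexpN (R : realType) (t : R) : cmod (cexpN t) = 1.
Proof. by rewrite /cmod /= sqrrN cos2Dsin2 sqrtr1. Qed.

(** A square root of the differenced bound: [A] and [D] are the roots of its two terms. The
    coefficient [1 + 48 / eps >= 1] is below its own square, and [2 * 4 <= 3 ^ 2]. *)
Lemma weyl_sum (R : realType) (M q a L : nat) (y eps b c : R) :
  (0 < M)%N -> (0 < q <= 2 * M)%N -> coprime a q ->
  `|q%:R * y - a%:R| * (2 * M)%:R < 1 -> 0 < eps < 1 -> (L <= M)%N ->
  cmod (\sum_(0 <= u < L) cexpN (pi * y * u%:R ^+ 2 + b * u%:R + c)) <=
  (1 + 48 / eps) * M%:R `^ ((1 + eps) / 2) + 3 * (M%:R * q%:R `^ (- (1 / 2)) *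
     Num.max 1 (M%:R ^+ 2 * `|y - a%:R / q%:R|) `^ (- (3 / 8))).
Proof.
move=> M0 /andP[q0 q2M] co aq e01 LM.
have [B [B0 Bs hB]] := @weyl_differencing R M L y b c LM.
have := sum_differenced_le M0 q0 q2M co aq B0 Bs e01.
set X := Num.max 1 _ => hW.
have X0 : 0 < X by rewrite lt_max ltr01.
have MR1 : 1 <= M%:R :> R by rewrite ler1n.
have MR0 : 0 < M%:R :> R by lra.
have qR0 : 0 < q%:R :> R by rewrite ltr0n.
set A := M%:R `^ ((1 + eps) / 2).
set D := M%:R * _ * _.
have A0 : 0 <= A by exact: powR_ge0.
have D0 : 0 <= D by rewrite !mulr_ge0 ?powR_ge0.
have AE : A ^+ 2 = M%:R * M%:R `^ eps.
  rewrite -powR_mulrn// -powRrM (_ : _ * _ = 1 + eps); last by lra.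
  by rewrite powRD_gt0// powRr1 ?ler0n.
have DE : D ^+ 2 = M%:R ^+ 2 / q%:R * X `^ (- (3 / 4)).
  rewrite /D !exprMn; congr (_ * _ * _); rewrite -powR_mulrn ?powR_ge0// -powRrM.
    by rewrite (_ : _ * _ = -1); [rewrite powR_inv1// ltW|lra].
  by congr (_ `^ _); lra.
have e0 : 0 < eps by lra.
have K1 : 0 < 1 / eps by rewrite divr_gt0.
have e48 : 48 / eps = 48 * (1 / eps) by rewrite mul1r.
have e24 : 24 / eps = 24 * (1 / eps) by rewrite mul1r.
have h0 : 0 <= (1 + 48 / eps) * A + 3 * D by rewrite addr_ge0// mulr_ge0//; lra.
rewrite -(ler_pXn2r (ltn0Sn 1)) ?nnegrE ?cmod_ge0// sqr_cmod Re_sum Im_sum /=.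
rewrite sumrN sqrrN; apply: (le_trans hB).
have h1 : M%:R <= A ^+ 2.
  rewrite AE ler_peMr//; last by rewrite -[X in X <= _](powRr0 M%:R) ler_powR// ltW.
move: hW; rewrite -AE -[4 * _ * _]mulrA -DE => hW.
rewrite e24 in hW; rewrite e48.
move: (1 / eps) K1 hW => k K1 hW.
have kA : 0 <= k * A ^+ 2 by rewrite mulr_ge0 ?sqr_ge0// ltW.
have kA2 : 0 <= k ^+ 2 * A ^+ 2 by rewrite mulr_ge0 ?sqr_ge0.
have kAD : 0 <= k * (A * D) by exact: (mulr_ge0 (ltW K1) (mulr_ge0 A0 D0)).
have AD : 0 <= A * D by exact: mulr_ge0.
have D2 := sqr_ge0 D.
rewrite (_ : (_ + _) ^+ 2 = A ^+ 2 + 96 * (k * A ^+ 2) + 48 ^+ 2 * (k ^+ 2 * A ^+ 2)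
   + 6 * (A * D) + 288 * (k * (A * D)) + 9 * D ^+ 2); last by ring.
lra.
Qed.

(** After summation by parts the coefficients [w M] and [w u - w u.+1] are nonnegative and add up to
    [w 0]. *)
Lemma abel_bound (R : realType) (w : nat -> R) (z : nat -> R[i]) (V : R) (M : nat) :
  (forall u, w u.+1 <= w u) -> (forall u, 0 <= w u) ->
  (forall L, (L <= M)%N -> cmod (\sum_(0 <= u < L) z u) <= V) ->
  cmod (\sum_(0 <= u < M) (w u)%:C%C * z u) <= w 0%N * V.
Proof.
move=> wdec w0 hV.
pose S L := \sum_(0 <= u < L) z u.
have abelE L : \sum_(0 <= u < L) (w u)%:C%C * z u =
    (w L)%:C%C * S L + \sum_(0 <= u < L) (w u - w u.+1)%:C%C * S u.+1.
  elim: L => [|L ih]; first by rewrite /S !big_geq// mulr0 addr0.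
  rewrite !(big_nat_recr L)//= ih.
  rewrite (_ : S L.+1 = S L + z L); last by rewrite /S big_nat_recr.
  by rewrite rmorphB /=; ring.
rewrite abelE; apply: (le_trans (cmodD _ _)).
rewrite cmodM cmodC ger0_norm//.
have -> : w 0%N * V = w M * V + \sum_(0 <= u < M) (w u - w u.+1) * V.
  rewrite -mulr_suml -mulrDl; congr (_ * _).
  by elim: M {hV} => [|m ->]; [rewrite big_geq ?addr0|rewrite big_nat_recr//=; ring].
rewrite lerD ?ler_wpM2l ?hV//.
apply: (le_trans (cmod_sum _ _ _)).
rewrite big_nat_cond [leRHS]big_nat_cond; apply: ler_sum => u /andP[/andP[_ uM] _].
by rewrite cmodM cmodC ger0_norm ?subr_ge0// ler_wpM2l ?subr_ge0// hV.
Qed.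

(** * Dyadic decomposition of the partial sums *)

Lemma big_dyadic (V : nmodType) (F : nat -> V) (J : nat) :
  \sum_(0 <= k < 2 ^ J) F k =
  F 0%N + \sum_(0 <= j < J) \sum_(2 ^ j <= k < 2 ^ j.+1) F k.
Proof.
elim: J => [|J ih]; first by rewrite big_nat1 big_geq// addr0.
rewrite big_nat_recr//= addrA -ih -big_cat_nat//=.
by rewrite leq_exp2l.
Qed.

Lemma geom_sum_le (R : realType) (r : R) (J : nat) : 0 <= r < 1 ->
  \sum_(0 <= j < J) r ^+ j <= (1 - r)^-1.
Proof.
move=> /andP[r0 r1]; rewrite -[leRHS]mul1r ler_pdivlMr; last by lra.
elim: J => [|J ih]; first by rewrite big_geq// mul0r.
suff -> : (\sum_(0 <= j < J.+1) r ^+ j) * (1 - r) = 1 - r ^+ J.+1.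
  by rewrite lerBlDr lerDl exprn_ge0.
elim: J {ih} => [|J ih]; first by rewrite big_nat1 expr0 mul1r expr1.
by rewrite big_nat_recr//= mulrDl ih [r ^+ J.+2]exprS; ring.
Qed.

Lemma powR_exp2 (R : realType) (t : R) (j : nat) :
  (2 ^ j)%:R `^ t = (2 `^ t) ^+ j :> R.
Proof.
by rewrite natrX -powR_mulrn// -powRrM mulrC powRrM powR_mulrn// powR_ge0.
Qed.

Definition rat_approx (R : realType) (M q a : nat) (y : R) :=
  [/\ (0 < q <= 2 * M)%N, coprime a q & `|q%:R * y - a%:R| * (2 * M)%:R < 1].

Definition peak (R : realType) (s : R) (M q a : nat) (y : R) : R :=
  M%:R `^ (1 - s) * (q%:R `^ (- (1 / 2)) *
    Num.max 1 (M%:R ^+ 2 * `|y - a%:R / q%:R|) `^ (- (3 / 8))).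

Section pointwise.
Context (R : realType) (N : nat) (chi : nat -> R[i]) (s : R).
Hypotheses (N0 : (0 < N)%N) (chiN : forall n, chi (n + N)%N = chi n).
Hypotheses (s0 : 1 / 2 < s) (s1 : s < 1).

Lemma chi_periodic k n : chi (k * N + n)%N = chi n.
Proof. by elim: k => [//|k ih]; rewrite mulSn -addnA addnC chiN. Qed.

Lemma chi_bounded : exists2 C : R, 0 < C & forall n, cmod (chi n) <= C.
Proof.
exists (1 + \sum_(c < N) cmod (chi c)).
  by rewrite ltr_pwDl// sumr_ge0// => c _; exact: cmod_ge0.
move=> n; rewrite (divn_eq n N) chi_periodic.
rewrite (bigD1 (Ordinal (ltn_pmod n N0)))//= addrCA lerDl addr_ge0// sumr_ge0// => c _.
exact: cmod_ge0.
Qed.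

Lemma mtermE n x : mterm s chi n x =
  chi n * ((n%:R `^ (- s))%:C%C * cexpN (2 * pi * (n ^ 2)%N%:R * x)).
Proof.
rewrite /mterm /cexpN; congr (_ * _).
by apply/eqP; rewrite eq_complex /= !mul0r subr0 addr0 mulrN !eqxx.
Qed.

(** On a residue class modulo [N] the character is constant and factors out. With [n = u N + A], the
    phase [2 pi n^2 x] has quadratic coefficient [pi (2 N^2 x)], independent of [r], so one rational
    approximation serves all classes. *)
Lemma block_bound (C : R) (M q a r : nat) (eps x : R) : (0 < M)%N ->
  (forall n, cmod (chi n) <= C) -> 0 < eps < 1 ->
  rat_approx M q a (2 * N%:R ^+ 2 * x) ->
  cmod (\sum_(M <= k < 2 * M) mterm s chi (k * N + r.+1)%N x) <=
   C * ((1 + 48 / eps) * M%:R `^ ((1 + eps) / 2 - s) +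
     3 * peak s M q a (2 * N%:R ^+ 2 * x)).
Proof.
move=> M0 hC e01 [q0 co aq].
have MR0 : 0 < M%:R :> R by rewrite ltr0n.
rewrite -{1}[M]add0n big_addn mul2n -addnn addnK.
pose A := (M * N + r.+1)%N.
pose w u : R := (u * N + A)%N%:R `^ (- s).
pose z u := cexpN (pi * (2 * N%:R ^+ 2 * x) * u%:R ^+ 2 +
  4 * pi * x * N%:R * A%:R * u%:R + 2 * pi * x * A%:R ^+ 2).
have -> : \sum_(0 <= i < M) mterm s chi ((i + M) * N + r.+1)%N x =
    chi r.+1 * \sum_(0 <= u < M) (w u)%:C%C * z u.
  rewrite mulr_sumr; apply: eq_bigr => u _.
  rewrite mtermE chi_periodic mulnDl -addnA -/A; congr (_ * (_ * cexpN _)).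
  by rewrite natrX natrD natrM; ring.
rewrite cmodM ler_pM ?cmod_ge0//.
have A0 : (0 < A)%N by rewrite /A addn_gt0 orbT.
have := @abel_bound R w z ((1 + 48 / eps) * M%:R `^ ((1 + eps) / 2) +
  3 * (M%:R * q%:R `^ (- (1 / 2)) *
     Num.max 1 (M%:R ^+ 2 * `|2 * N%:R ^+ 2 * x - a%:R / q%:R|) `^ (- (3 / 8)))) M.
have wle (m n : nat) : (0 < m)%N -> (m <= n)%N -> n%:R `^ (- s) <= m%:R `^ (- s) :> R.
  move=> m0 mn; rewrite !powRN lef_pV2 ?posrE ?powR_gt0 ?ltr0n//; last exact: leq_trans mn.
  have s_ge0 : 0 <= s by move: s0 => s_gt; lra.
  by apply: ge0_ler_powR; rewrite ?nnegrE ?ler0n ?ler_nat.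
move=> /(_ _ _ _)/le_trans; apply.
- by move=> u; apply: wle; [rewrite addn_gt0 A0 orbT|rewrite leq_add2r leq_mul2r leqnSn orbT].
- by move=> u; exact: powR_ge0.
- by move=> L LM; exact: weyl_sum.
rewrite (_ : w 0%N = A%:R `^ (- s)); last by rewrite /w mul0n.
apply: (@le_trans _ _ (M%:R `^ (- s) * ((1 + 48 / eps) * M%:R `^ ((1 + eps) / 2) +
  3 * (M%:R * q%:R `^ (- (1 / 2)) *
     Num.max 1 (M%:R ^+ 2 * `|2 * N%:R ^+ 2 * x - a%:R / q%:R|) `^ (- (3 / 8)))))).
  rewrite ler_wpM2r//.
    have e0 : 0 <= eps by case/andP: e01 => /ltW.
    have K0 : 0 <= 1 + 48 / eps by rewrite addr_ge0// divr_ge0.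
    by apply: addr_ge0; rewrite mulr_ge0 ?powR_ge0// !mulr_ge0 ?powR_ge0.
  by apply: wle => //; rewrite /A (leq_trans (leq_pmulr _ N0))// leq_addr.
apply: eq_ler; rewrite /peak (_ : 1 - s = - s + 1); last by ring.
rewrite (_ : (1 + eps) / 2 - s = - s + (1 + eps) / 2); last by ring.
by rewrite !(powRD_gt0 _ _ MR0) powRr1 ?ler0n//; ring.
Qed.

Lemma mpartial_le_peaks : exists C0 C1 : R, [/\ 0 < C0, 0 < C1 &
  forall (J : nat) (x : R), 0 <= x -> exists q a : nat -> nat,
  (forall j, rat_approx (2 ^ j) (q j) (a j) (2 * N%:R ^+ 2 * x)) /\
  cmod (mpartial s chi (2 ^ J * N) x) <= C0 + C1 * \sum_(0 <= j < J)
     peak s (2 ^ j) (q j) (a j) (2 * N%:R ^+ 2 * x)].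
Proof.
have [C C0 hC] := chi_bounded; move: s0 s1 => s_gt s_lt.
(* With this choice [t = - (s - 1/2) / 2] is negative, and the first terms of the block bounds form
   a geometric series of ratio [rho < 1]. *)
pose eps := s - 1 / 2.
have e01 : 0 < eps < 1 by rewrite /eps; lra.
have e0 : 0 < eps by lra.
pose t : R := (1 + eps) / 2 - s.
pose rho : R := 2 `^ t.
have rho01 : 0 <= rho < 1.
  rewrite powR_ge0/= -(powRr0 2) /rho /powR gt_eqF// ltr_expR mul0r.
  by have : 0 < ln 2 :> R; [rewrite ln_gt0//; lra|rewrite /t /eps; nra].
have K0 : 0 < 1 + 48 / eps by rewrite addr_gt0// divr_gt0.
have G0 : 0 < (1 - rho)^-1 by rewrite invr_gt0; lra.
exists (N%:R * (C * (1 + (1 + 48 / eps) * (1 - rho)^-1))), (N%:R * (C * 3)).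
have NR0 : 0 < N%:R :> R by rewrite ltr0n.
split; [by rewrite !mulr_gt0// addr_gt0// mulr_gt0|by rewrite !mulr_gt0|].
move=> J x x0; set y := 2 * _ * x.
have y0 : 0 <= y by rewrite !mulr_ge0.
have /choice[qa hqa] : forall j, exists qa : nat * nat, rat_approx (2 ^ j) qa.1 qa.2 y.
  move=> j; have [|q [a h]] := @dirichlet_approx R y (2 * 2 ^ j) y0.
    by rewrite muln_gt0 expn_gt0.
  by exists (q, a).
exists (fun j => (qa j).1), (fun j => (qa j).2); split => //.
set S := \sum_(0 <= j < J) _.
rewrite /mpartial big_add1/= big_nat_mul exchange_big/=.
apply: (le_trans (cmod_sum _ _ _)).
rewrite -mulrA -mulrDr.
apply: (@le_trans _ _ (\sum_(0 <= r < N) (C * (1 + (1 + 48 / eps) * (1 - rho)^-1) + C * 3 * S)));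
  last by rewrite big_const_nat iter_addr_0 subn0 [N%:R * _]mulr_natl.
apply: ler_sum => r _.
under eq_bigr do rewrite -addnS.
(* The index [k = 0] lies in no dyadic block; its term [n = r + 1] has modulus at most [C], the
   summand 1 in the constant. *)
rewrite big_dyadic; apply: (le_trans (cmodD _ _)).
rewrite -[C * 3 * S]mulrA -mulrDr -addrA mulrDr mulr1 lerD//.
  rewrite mul0n add0n mtermE !cmodM cmod_cexpN mulr1 cmodC ger0_norm ?powR_ge0//.
  rewrite -[leRHS]mulr1 ler_pM ?cmod_ge0 ?powR_ge0// powRN invf_le1 ?powR_gt0//.
  apply: (@le_trans _ _ (r.+1%:R `^ 0)); first by rewrite powRr0.
  by apply: ler_powR; [rewrite ler1n|lra].
apply: (le_trans (cmod_sum _ _ _)).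
have M0 j : (0 < 2 ^ j)%N by rewrite expn_gt0.
apply: (@le_trans _ _ (\sum_(0 <= j < J) C * ((1 + 48 / eps) * (2 ^ j)%:R `^ t +
     3 * peak s (2 ^ j) (qa j).1 (qa j).2 y))).
  apply: ler_sum => j _; rewrite expnS.
  exact: (block_bound r (M0 j) hC e01 (hqa j)).
rewrite -mulr_sumr ler_pM2l// big_split/= -!mulr_sumr lerD2r ler_pM2l//.
under eq_bigr do rewrite powR_exp2.
exact: geom_sum_le.
Qed.

End pointwise.

(** * Level sets of the peaks *)

(** Squaring [tau < peak] gives [q X^(3/4) < Q]. The two conclusions use [X >= 1] and
    [X >= M^2 |y - a/q|] respectively. *)
Lemma peak_level_set (R : realType) (s tau y : R) (M q a : nat) :
  (0 < M)%N -> (0 < q)%N -> 0 < tau -> tau < peak s M q a y ->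
  let Q := (M%:R `^ (1 - s) / tau) ^+ 2 in
  q%:R < Q /\ `|y - a%:R / q%:R| < (M%:R ^+ 2)^-1 * (Q / q%:R) `^ (4 / 3).
Proof.
move=> M0 q0 t0 tP Q; move: tP; rewrite /peak; set X := Num.max _ _ => tP.
have MR0 : 0 < M%:R :> R by rewrite ltr0n.
have qR0 : 0 < q%:R :> R by rewrite ltr0n.
have X1 : 1 <= X by rewrite le_max lexx.
have X0 : 0 < X by lra.
rewrite {}/Q; set D := M%:R `^ (1 - s) in tP *; set Q := (D / tau) ^+ 2.
have D0 : 0 < D by exact: powR_gt0.
have P0 : 0 < q%:R `^ (1 / 2) * X `^ (3 / 8) by rewrite mulr_gt0 ?powR_gt0.
have : q%:R `^ (1 / 2) * X `^ (3 / 8) < D / tau.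
  rewrite ltr_pdivlMr// mulrC -ltr_pdivlMr//.
  by move: tP; rewrite !powRN -invfM.
have h2 (u v : R) : 0 < u -> u < v -> u ^+ 2 < v ^+ 2.
  by move=> u0 uv; rewrite ltr_pXn2r ?nnegrE//; lra.
move=> /(h2 _ _ P0); rewrite -/Q exprMn.
have -> : (q%:R `^ (1 / 2)) ^+ 2 = q%:R :> R.
  rewrite -powR_mulrn ?powR_ge0// -powRrM (_ : _ * _ = 1) ?powRr1 ?ler0n//; lra.
have -> : (X `^ (3 / 8)) ^+ 2 = X `^ (3 / 4).
  by rewrite -powR_mulrn ?powR_ge0// -powRrM; congr (_ `^ _); lra.
move=> hQ; split.
  apply: le_lt_trans hQ; rewrite ler_peMr ?ler0n//.
  by rewrite -[X in X <= _](powRr0 X) ler_powR//; lra.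
rewrite [ltRHS]mulrC ltr_pdivlMr ?exprn_gt0// [ltLHS]mulrC.
apply: (@le_lt_trans _ _ X); first by rewrite le_max lexx orbT.
have -> : X = (X `^ (3 / 4)) `^ (4 / 3).
  have e : 3 / 4 * (4 / 3) = 1 :> R by lra.
  by rewrite -powRrM e powRr1// ltW.
apply: gt0_ltr_powR; rewrite ?nnegrE ?powR_ge0//.
  by rewrite divr_ge0 ?sqr_ge0// ltW.
by rewrite ltr_pdivlMr// mulrC.
Qed.

Lemma measure_bigsetU_le (R : realType) (I : eqType) (r : seq I) (F : I -> set R)
  (m : I -> R) :
  (forall i, i \in r -> measurable (F i) /\ (lebesgue_measure (F i) <= (m i)%:E)%E) ->
  measurable (\big[setU/set0]_(i <- r) F i) /\
  (lebesgue_measure (\big[setU/set0]_(i <- r) F i) <= (\sum_(i <- r) m i)%:E)%E.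
Proof.
elim: r => [|i r ih] h; first by rewrite !big_nil measure0.
have [mi hi] := h i (mem_head _ _).
have [|mr hr] := ih; first by move=> j jr; apply: h; rewrite inE jr orbT.
rewrite !big_cons; split; first exact: measurableU.
rewrite EFinD; have hU := measureU2 (@lebesgue_measure R) mi mr.
apply: (le_trans hU).
exact: leeD.
Qed.

(** [E] must not depend on how each [x] is approximated, so it takes all [q <= Q] and all
    [a <= q Y]. In the variable [x] there are [Y] times more intervals, each [Y] times shorter, so
    [N] cancels. The fractions of denominator [q] cost [4 M^(-2) Q^(4/3) q^(-1/3)], which sums to
    [6 M^(-2) Q^2]. *)
Lemma level_set_cover (R : realType) (s tau : R) (M N : nat) :
  (0 < M)%N -> (0 < N)%N -> 0 < tau ->
  exists E : set R, [/\ measurable E,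
    (lebesgue_measure E <= (6 * M%:R `^ (2 - 4 * s) / tau ^+ 4)%:E)%E &
    forall x q a, 0 <= x <= 1 -> rat_approx M q a (2 * N%:R ^+ 2 * x) ->
      tau < peak s M q a (2 * N%:R ^+ 2 * x) -> E x].
Proof.
move=> M0 N0 t0.
have MR0 : 0 < M%:R :> R by rewrite ltr0n.
pose Y := (2 * N ^ 2)%N.
have Y0 : (0 < Y)%N by rewrite muln_gt0/= expn_gt0 N0.
have YR0 : 0 < Y%:R :> R by rewrite ltr0n.
have YE : 2 * N%:R ^+ 2 = Y%:R :> R by rewrite natrM natrX.
rewrite YE.
pose Q := (M%:R `^ (1 - s) / tau) ^+ 2.
have Q0 : 0 < Q by rewrite exprn_gt0// divr_gt0// powR_gt0.
pose rad (q : nat) := (M%:R ^+ 2)^-1 * (Q / q%:R) `^ (4 / 3).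
have rad0 q : 0 <= rad q by rewrite mulr_ge0 ?powR_ge0// invr_ge0 sqr_ge0.
pose I (q a : nat) : set R :=
  `[a%:R / q%:R / Y%:R - rad q / Y%:R, a%:R / q%:R / Y%:R + rad q / Y%:R]%classic.
pose n := Num.truncn Q.
pose F q := \big[setU/set0]_(a <- index_iota 0 (q * Y).+1) I q a.
have hI q a : measurable (I q a) /\
    (lebesgue_measure (I q a) <= (2 * (rad q / Y%:R))%:E)%E.
  split; first exact: measurable_itv.
  rewrite lebesgue_measure_itv/= lte_fin; case: ifP => _.
    by rewrite -EFinD lee_fin; lra.
  by rewrite lee_fin mulr_ge0// divr_ge0.
have hF q : q \in index_iota 1 n.+1 -> measurable (F q) /\
    (lebesgue_measure (F q) <=
      (4 * ((M%:R ^+ 2)^-1 * Q `^ (4 / 3)) * q%:R `^ (- (1 / 3)))%:E)%E.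
  rewrite mem_index_iota => /andP[q0 _].
  have [mF /le_trans] := measure_bigsetU_le (fun a (_ : a \in index_iota 0 (q * Y).+1) => hI q a).
  move=> h; split => //; apply: h.
  have qR0 : 0 < q%:R :> R by rewrite ltr0n.
  rewrite lee_fin big_const_nat subn0 iter_addr_0 -[_ *+ (q * Y).+1]mulr_natr.
  apply: (@le_trans _ _ (2 * (rad q / Y%:R) * (2 * (q%:R * Y%:R)))).
    have r0 : 0 <= 2 * (rad q / Y%:R) by rewrite mulr_ge0// divr_ge0.
    rewrite (ler_wpM2l r0)// -!natrM ler_nat.
    have : (0 < q * Y)%N by rewrite muln_gt0 q0.
    lia.
  rewrite (_ : 2 * (rad q / Y%:R) * (2 * (q%:R * Y%:R)) = 4 * (rad q * q%:R)); last first.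
    by field; rewrite gt_eqF.
  apply: eq_ler; rewrite -[RHS]mulrA; congr (4 * _).
  rewrite /rad -[LHS]mulrA -[RHS]mulrA; congr (_ * _).
  rewrite powRM ?invr_ge0 ?(ltW Q0) ?(ltW qR0)// -mulrA; congr (_ * _).
  have -> : - (1 / 3) = - (4 / 3) + 1 :> R by lra.
  by rewrite powRV ?(ltW qR0)// powRD_gt0// powRr1 ?(ltW qR0)// powRN.
have [mE hE] := measure_bigsetU_le hF.
exists (\big[setU/set0]_(q <- index_iota 1 n.+1) F q); split => //.
  apply: (le_trans hE); rewrite lee_fin -mulr_sumr.
  have := @sum_powRN_le R (1 / 3) n ltac:(lra).
  rewrite (_ : 1 - 1 / 3 = 2 / 3); last by lra.
  have -> : (2 / 3)^-1 = 3 / 2 :> R by rewrite invf_div.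
  have nQ : n%:R `^ (2 / 3) <= Q `^ (2 / 3).
    apply: ge0_ler_powR; rewrite ?nnegrE ?ler0n ?(ltW Q0)//.
    by have /truncn_itv/andP[] := ltW Q0.
  have K0 : 0 <= 4 * ((M%:R ^+ 2)^-1 * Q `^ (4 / 3)).
    by rewrite !mulr_ge0 ?powR_ge0// invr_ge0 sqr_ge0.
  move=> hs; apply: (@le_trans _ _ (4 * ((M%:R ^+ 2)^-1 * Q `^ (4 / 3)) * (Q `^ (2 / 3) * (3 / 2)))).
    by rewrite ler_wpM2l// (le_trans hs)// ler_wpM2r//; lra.
  rewrite (_ : _ * (_ * (3 / 2)) = 6 * ((M%:R ^+ 2)^-1 * (Q `^ (4 / 3) * Q `^ (2 / 3)))); last first.
    by move: (_^-1) (Q `^ _) (Q `^ _) => ? ? ?; lra.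
  rewrite -powRD_gt0// (_ : 4 / 3 + 2 / 3 = 2%:R); last by lra.
  rewrite (powR_mulrn _ (ltW Q0)) /Q.
  rewrite -mulrA; apply: eq_ler; congr (_ * _).
  rewrite -exprM expr_div_n mulrA; congr (_ / _).
  rewrite -(powR_mulrn _ (ltW MR0)) -powRN -powR_mulrn ?powR_ge0// -powRrM -powRD_gt0//.
  by congr (_ `^ _); ring.
move=> x q a /andP[x0 x1] [/andP[q0 q2M] co aq] tP.
have qR0 : 0 < q%:R :> R by rewrite ltr0n.
have [qQ hx] := peak_level_set M0 q0 t0 tP.
rewrite -bigcup_seq; exists q => /=.
  rewrite mem_index_iota q0 ltnS /n truncn_ge_nat ?(ltW Q0)//; exact: ltW.
rewrite /F -bigcup_seq; exists a => /=.
  (* As [x <= 1] and [|q y - a| < 1], the numerator satisfies [a < q Y + 1]. *)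
  rewrite mem_index_iota/= ltnS -ltnS -(ltr_nat R) -natr1 natrM.
  have M1 : 1 <= (2 * M)%:R :> R by rewrite ler1n muln_gt0.
  have : `|q%:R * (Y%:R * x) - a%:R| < 1.
    by apply: le_lt_trans aq; rewrite ler_peMr.
  rewrite ltr_norml => /andP[h1 h2].
  have : q%:R * (Y%:R * x) <= q%:R * Y%:R :> R.
    by rewrite ler_pM2l// -[leRHS]mulr1 ler_pM2l.
  lra.
move: hx; rewrite -/(rad q) ltr_norml => /andP[h1 h2].
rewrite /I /= in_itv/= -mulrBl -mulrDl ler_pdivrMr// ler_pdivlMr// (mulrC x).
by apply/andP; split; lra.
Qed.

(** * Weak-type bound for the partial sums *)

Lemma exp_bracket (R : realType) (rho gam : R) : 1 < rho -> 1 <= gam ->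
  exists j : nat, rho ^+ j <= gam < rho ^+ j.+1.
Proof.
move=> r1 g1.
have lr : 0 < ln rho by rewrite ln_gt0.
have r0 : 0 < rho by lra.
have g0 : 0 < gam by lra.
pose t := ln gam / ln rho.
have t0 : 0 <= t by rewrite divr_ge0 ?ln_ge0// ltW.
have gE : gam = rho `^ t.
  by rewrite /powR gt_eqF// /t divfK ?gt_eqF// lnK.
have /andP[h1 h2] := truncn_itv t0.
exists (Num.truncn t); rewrite -!(powR_mulrn _ (ltW r0)); apply/andP; split.
  by rewrite [leRHS]gE ler_powR// ltW.
by rewrite [ltLHS]gE /powR gt_eqF// ltr_expR ltr_pM2r.
Qed.

(** Each half of [beta] is accounted for separately: the trivial bounds [rho^j] below [j0] sum to at
    most [beta / 2], and the factor [(1 - sigma^-1) / 2] makes the thresholds sum to at most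
    [beta / 2] as well. *)
Lemma peaks_exceed (R : realType) (rho sigma beta : R) (j0 J : nat) (P : nat -> R) :
  1 < rho -> 1 < sigma -> 0 < beta -> rho ^+ j0 <= (rho - 1) * beta / 2 ->
  (forall j, 0 <= P j <= rho ^+ j) -> beta < \sum_(0 <= j < J) P j ->
  exists i, (i < J)%N /\ (1 - sigma^-1) / 2 * beta / sigma ^+ i < P (j0 + i)%N.
Proof.
move=> r1 s1 b0 hj0 hP hb; apply: contrapT => /forallNP hN.
have s0 : 0 < sigma by lra.
have si0 : 0 < sigma^-1 by rewrite invr_gt0.
have si1 : sigma^-1 < 1 by rewrite invf_lt1.
move: hb; apply/negP; rewrite -leNgt.
(* Lengthening the sum allows the cut at [j0] even when [J < j0]. *)
apply: (@le_trans _ _ (\sum_(0 <= j < j0 + J) P j)).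
  rewrite [leRHS](big_cat_nat _ (leq_addl j0 J))//= lerDl sumr_ge0// => j _.
  by have /andP[] := hP j.
rewrite (big_cat_nat _ (leq_addr J j0))//=.
have h1 : \sum_(0 <= j < j0) P j <= beta / 2.
  apply: (@le_trans _ _ (\sum_(0 <= j < j0) rho ^+ j)).
    by apply: ler_sum => j _; have /andP[] := hP j.
  have gE : (\sum_(0 <= j < j0) rho ^+ j) * (rho - 1) = rho ^+ j0 - 1.
    elim: j0 {hj0 hN} => [|j ih]; first by rewrite big_geq// mul0r subrr.
    by rewrite big_nat_recr//= mulrDl ih exprS; ring.
  rewrite -(@ler_pM2r _ (rho - 1)) ?subr_gt0// gE; lra.
have h2 : \sum_(j0 <= j < j0 + J) P j <= beta / 2.
  rewrite -{1}[j0]add0n big_addn addKn.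
  pose k := (1 - sigma^-1) / 2 * beta.
  have k0 : 0 < k by rewrite !mulr_gt0//; lra.
  apply: (@le_trans _ _ (\sum_(0 <= i < J) k * (sigma^-1) ^+ i)).
    rewrite big_nat_cond [leRHS]big_nat_cond; apply: ler_sum => i /andP[/andP[_ iJ] _].
    have /not_andP[//|/negP] := hN i.
    by rewrite -leNgt addnC exprVn.
  rewrite -mulr_sumr.
  apply: (le_trans (ler_wpM2l (ltW k0) (geom_sum_le J _))); first by rewrite ltW.
  by apply: eq_ler; rewrite /k; field; rewrite subr_eq0 gt_eqF// gt_eqF.
lra.
Qed.

Lemma powR2_gt1 (R : realType) (t : R) : 0 < t -> 1 < 2 `^ t.
Proof. by move=> t0; rewrite /powR gt_eqF// expR_gt1 mulr_gt0// ln_gt0; lra. Qed.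

Lemma powR2_lt1 (R : realType) (t : R) : t < 0 -> 2 `^ t < 1.
Proof.
move=> t0; rewrite -[t]opprK powRN invf_lt1 ?powR_gt0//.
by apply: powR2_gt1; rewrite oppr_gt0.
Qed.

Lemma mpartial_weak_type (R : realType) (N : nat) (chi : nat -> R[i]) (s : R) :
  (0 < N)%N -> (forall n, chi (n + N)%N = chi n) -> 1 / 2 < s -> s < 1 ->
  exists2 c : R, 0 < c & forall (J : nat) (alpha : R), 0 < alpha ->
    exists E : set R, [/\ measurable E,
      (lebesgue_measure E <= (c * alpha `^ (- (2 / (1 - s))))%:E)%E &
      forall x, 0 <= x <= 1 -> alpha < cmod (mpartial s chi (2 ^ J * N) x) -> E x].
Proof.
move=> N0 chiN s0 s1.
have [C0 [C1 [C00 C10 hm]]] := mpartial_le_peaks N0 chiN s0 s1.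
pose p := 2 / (1 - s).
pose rho : R := 2 `^ (1 - s).
pose theta : R := 2 `^ (2 - 4 * s).
(* Lowering the thresholds by [sigma] per block costs [sigma^4] in measure. As
   [sigma^4 = theta^(-1/2)], half of the decay [theta] is spent and [eta = theta^(1/2) < 1]
   remains. *)
pose sigma : R := 2 `^ ((4 * s - 2) / 8).
pose eta : R := 2 `^ (1 - 2 * s).
(* Chosen so that [theta = rho^(-e)]; then [e + 4 = p], the 4 coming from [tau^(-4)]. *)
pose e := (4 * s - 2) / (1 - s).
have r1 : 1 < rho by apply: powR2_gt1; lra.
have sg1 : 1 < sigma by apply: powR2_gt1; lra.
have eta1 : eta < 1 by apply: powR2_lt1; lra.
have eta0 : 0 <= eta by exact: powR_ge0.
have theta0 : 0 < theta by exact: powR_gt0.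
have sg0 : 0 < sigma by lra.
have es : theta * sigma ^+ 4 = eta.
  rewrite /theta /sigma /eta -powR_mulrn ?powR_ge0// -powRrM -powRD_gt0//.
  by congr (_ `^ _); lra.
pose kap : R := (1 - sigma^-1) / 2.
have kap0 : 0 < kap by rewrite divr_gt0// subr_gt0 invf_lt1.
(* The bracket [gam < rho^(j0 + 1)] below reads [lam * beta < rho^j0]. *)
pose lam := (rho - 1) / 2 / rho.
have lam0 : 0 < lam by rewrite /lam divr_gt0 ?divr_gt0//; lra.
pose D := 6 / (1 - eta) / kap ^+ 4.
have D0 : 0 < D by rewrite /D divr_gt0 ?exprn_gt0// divr_gt0//; lra.
(* If [C0 + C1 S > alpha] and [alpha > 2 C0], then [S > b alpha]. *)
pose b := (2 * C1)^-1.
have b0 : 0 < b by rewrite invr_gt0; lra.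
pose c1 := D * lam `^ (- e) * b `^ (- p).
have c10 : 0 < c1 by exact: (mulr_gt0 (mulr_gt0 D0 (powR_gt0 _ lam0)) (powR_gt0 _ b0)).
(* Below [al0] the trivial bound [measure <= 1] suffices. *)
pose al0 := 2 * C0 + 2 / (rho - 1) / b.
have rb0 : 0 < 2 / (rho - 1) / b by apply: divr_gt0 => //; apply: divr_gt0; lra.
have al00 : 0 < al0 by rewrite /al0; lra.
have p0 : 0 < p by rewrite divr_gt0//; lra.
exists (al0 `^ p + c1); first by rewrite addr_gt0// powR_gt0.
move=> J alpha a0.
have aP : 0 < alpha `^ (- p) by exact: powR_gt0.
have [small|big] := leP alpha al0.
  exists `[0, 1]%classic; split => //.
  rewrite lebesgue_measure_itv/= lte_fin ltr01 -EFinD lee_fin subr0.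
  have h : alpha `^ p <= al0 `^ p.
    by apply: ge0_ler_powR => //; rewrite ?nnegrE; exact: ltW.
  rewrite mulrDl -/p; apply: (@le_trans _ _ (al0 `^ p * alpha `^ (- p))).
    by rewrite powRN ler_pdivlMr ?powR_gt0// mul1r.
  by rewrite lerDl; apply: mulr_ge0; exact: ltW.
pose beta := b * alpha.
have beta0 : 0 < beta by exact: mulr_gt0.
have bigb : 2 / (rho - 1) <= beta.
  rewrite /beta [leRHS]mulrC -ler_pdivrMr//; apply: le_trans (ltW big).
  by rewrite /al0 lerDr; apply: mulr_ge0 => //; exact: ltW.
(* The second summand of [al0] ensures [gam >= 1], without which no natural [j0] has
   [rho^j0 <= gam]. Blocks below [j0] are the harmless ones. *)
pose gam := (rho - 1) * beta / 2.
have g1 : 1 <= gam.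
  have := ler_wpM2l (_ : 0 <= rho - 1) bigb => /(_ ltac:(lra)).
  rewrite mulrCA divff ?gt_eqF ?subr_gt0// mulr1 /gam => h.
  by rewrite ler_pdivlMr// mul1r.
have [j0 /andP[hj0 hj1]] := exp_bracket r1 g1.
pose tau i := kap * beta / sigma ^+ i.
have tau0 i : 0 < tau i by apply: divr_gt0; [exact: mulr_gt0|exact: exprn_gt0].
have M0 i : (0 < 2 ^ (j0 + i))%N by rewrite expn_gt0.
have /choice[E hE] := fun i => @level_set_cover R s (tau i) (2 ^ (j0 + i)) N (M0 i) N0 (tau0 i).
pose m i := 6 * theta ^+ j0 / (kap * beta) ^+ 4 * eta ^+ i.
have [|mE muE] := @measure_bigsetU_le R nat (index_iota 0 J) E m.
  move=> i _; have [mEi muEi _] := hE i; split => //.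
  apply: (le_trans muEi); rewrite lee_fin powR_exp2 -/theta /tau /m.
  move: (kap * beta) => k.
  rewrite expr_div_n invf_div exprD -es exprMn -!exprM (mulnC i 4); apply: eq_ler.
  move: (theta ^+ j0) (theta ^+ i) (sigma ^+ _) (k ^- 4) => u v w z; ring.
exists (\big[setU/set0]_(i <- index_iota 0 J) E i); split => //.
  apply: (le_trans muE); rewrite lee_fin -mulr_sumr.
  have K0 : 0 <= 6 * theta ^+ j0 / (kap * beta) ^+ 4.
    by apply/ltW/divr_gt0; [apply: mulr_gt0 => //; exact: exprn_gt0|exact/exprn_gt0/mulr_gt0].
  apply: (le_trans (ler_wpM2l K0 (geom_sum_le J (_ : 0 <= eta < 1)))).
    by rewrite eta0.
  have thE : theta ^+ j0 <= (lam * beta) `^ (- e).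
    have -> : theta ^+ j0 = (rho ^+ j0) `^ (- e).
      have thetaE : theta ^+ j0 = 2 `^ ((2 - 4 * s) * j0%:R).
        by rewrite powRrM powR_mulrn ?powR_ge0.
      have rhoE : rho ^+ j0 = 2 `^ ((1 - s) * j0%:R).
        by rewrite powRrM powR_mulrn ?powR_ge0.
      rewrite thetaE rhoE -powRrM; congr (2 `^ _).
      by rewrite /e; field; rewrite subr_eq0 gt_eqF.
    have lb0 : 0 < lam * beta := mulr_gt0 lam0 beta0.
    have rj0 : 0 < rho ^+ j0 by rewrite exprn_gt0//; lra.
    have e0 : 0 <= e by apply: divr_ge0; lra.
    rewrite !powRN lef_pV2 ?posrE ?powR_gt0//.
    apply: ge0_ler_powR; rewrite ?nnegrE// ?ltW//.
    rewrite (_ : lam * beta = (rho - 1) / 2 * beta / rho) ; last first.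
      by rewrite /lam mulrAC.
    rewrite ltr_pdivrMr; last by lra.
    by rewrite -exprSr; apply: le_lt_trans hj1; apply: eq_ler; rewrite /gam; ring.
  rewrite -/p [leRHS]mulrDl; apply: (@le_trans _ _ (c1 * alpha `^ (- p))); last first.
    by rewrite lerDr; apply: mulr_ge0; [exact: powR_ge0|exact: ltW].
  apply: (@le_trans _ _ (D * ((lam * beta) `^ (- e) * beta `^ (- 4)))).
    rewrite (_ : _ / (1 - eta) = D * (theta ^+ j0 * beta ^- 4)); last first.
      rewrite /D exprMn invfM; ring.
    rewrite ler_pM2l// (_ : beta ^- 4 = beta `^ (- 4)); last first.
      by rewrite -(powR_invn _ (ltW beta0)).
    by rewrite ler_wpM2r ?powR_ge0.
  have -> : (lam * beta) `^ (- e) * beta `^ (- 4) =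
      lam `^ (- e) * (b `^ (- p) * alpha `^ (- p)).
    rewrite (powRM _ (ltW lam0) (ltW beta0)) -[LHS]mulrA; congr (_ * _).
    rewrite -(powRD_gt0 _ _ beta0) -(powRM _ (ltW b0) (ltW a0)); congr (_ `^ _).
    by rewrite /e /p; field; rewrite subr_eq0 gt_eqF.
  by apply: eq_ler; rewrite /c1; ring.
move=> x x01 hx.
have [q [a [hqa hle]]] := hm J x ltac:(lra).
set P := fun j => peak s (2 ^ j) (q j) (a j) (2 * N%:R ^+ 2 * x).
have PP j : 0 <= P j <= rho ^+ j.
  rewrite /P /peak !mulr_ge0 ?powR_ge0//= powR_exp2 -/rho.
  rewrite -[leRHS]mulr1 ler_wpM2l ?exprn_ge0 ?powR_ge0// -[leRHS]mulr1.
  have le1 (z t : R) : 1 <= z -> 0 <= t -> z `^ (- t) <= 1.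
    move=> z1 t0; apply: (@le_trans _ _ (z `^ 0)); last by rewrite powRr0.
    by apply: ler_powR => //; lra.
  have [/andP[q0 _] _ _] := hqa j.
  apply: ler_pM; rewrite ?powR_ge0//; apply: le1; rewrite ?divr_ge0//.
    by rewrite ler1n.
  by rewrite le_max lexx.
have hb : beta < \sum_(0 <= j < J) P j.
  have := lt_le_trans hx hle; rewrite -/P => h.
  have big2 : 2 * C0 < alpha by apply: le_lt_trans big; rewrite /al0 lerDl; exact: ltW.
  rewrite /beta /b [ltLHS]mulrC ltr_pdivrMr; last by lra.
  by move: h; move: (\sum_(0 <= j < J) _) => S h; nra.
have [i [iJ hi]] := peaks_exceed r1 sg1 beta0 hj0 PP hb.
rewrite -bigcup_seq; exists i => /=; first by rewrite mem_index_iota.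
by have [_ _] := hE i; apply; [exact: x01|exact: (hqa (j0 + i)%N)|].
Qed.

(** * Parseval's identity for the partial sums *)

(* [v] is the integral of [g] over [0, 1], witnessed by a primitive of [g]. *)
Definition has_mean (R : realType) (g : R -> R) (v : R) : Prop :=
  continuous g /\
  exists F : R -> R, (forall x : R, is_derive x 1 F (g x)) /\ F 1 - F 0 = v.

Section has_mean_theory.
Context (R : realType).
Implicit Types (f g : R -> R) (a v k : R).

Lemma has_mean_ext f g v : f =1 g -> has_mean f v -> has_mean g v.
Proof. by move=> /funext ->. Qed.

Lemma has_meanD f g a v : has_mean f a -> has_mean g v ->
  has_mean (fun x => f x + g x) (a + v).
Proof.
move=> [cf [F [dF <-]]] [cg [G [dG <-]]]; split.
  by move=> x; apply: cvgD; [exact: cf|exact: cg].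
exists (fun x => F x + G x); split; last by ring.
by move=> x; have hF := dF x; have hG := dG x; exact: is_deriveD.
Qed.

Lemma has_meanZ f v k : has_mean f v -> has_mean (fun x => k * f x) (k * v).
Proof.
move=> [cf [F [dF <-]]]; split.
  by move=> x; apply: cvgM; [exact: cvg_cst|exact: cf].
exists (fun x => k * F x); split; last by ring.
by move=> x; have hF := dF x; exact: is_deriveZ.
Qed.

Lemma has_mean_cst v : has_mean (fun=> v) v.
Proof.
split; first by move=> x; exact: cvg_cst.
exists (fun x => v * x); split; last by ring.
move=> x; rewrite -[X in is_derive _ _ _ X]mulr1.
exact: (@is_deriveZ _ _ _ id v).
Qed.

Lemma has_mean_sum (n : nat) (f : nat -> R -> R) :
  (forall i, (i < n)%N -> has_mean (f i) 0) ->
  has_mean (fun x => \sum_(0 <= i < n) f i x) 0.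
Proof.
elim: n => [|n ih] hf.
  by apply: has_mean_ext (has_mean_cst 0) => x; rewrite big_geq.
have := has_meanD (ih (fun i hi => hf i (ltnW hi))) (hf n (ltnSn n)).
by rewrite addr0; apply: has_mean_ext => x; rewrite big_nat_recr.
Qed.

Lemma continuous_scale k : continuous (fun x : R => k * x).
Proof. by move=> x; apply: cvgM; [exact: cvg_cst|exact: cvg_id]. Qed.

Lemma is_derive_scale k (x : R) : is_derive x 1 (fun z : R => k * z) k.
Proof. by rewrite -[X in is_derive _ _ _ X]mulr1; exact: (@is_deriveZ _ _ _ id k). Qed.

Let freq (m : nat) : R := 2 * pi * m%:R.

Let freq_neq0 m : (0 < m)%N -> freq m != 0.
Proof. by move=> m0; rewrite !mulf_neq0// ?gt_eqF ?pi_gt0// ltr0n. Qed.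

Let trig_freq m : (cos (freq m) = 1) * (sin (freq m) = 0).
Proof.
rewrite /freq (_ : 2 * pi * m%:R = 0 + (pi *+ 2) *+ m); last by rewrite mulr_natl mulr_natr add0r.
by rewrite (periodicn (@cosD2pi R)) (periodicn (@sinD2pi R)) cos0 sin0.
Qed.

Lemma has_mean_cos (m : nat) : (0 < m)%N -> has_mean (fun x : R => cos (2 * pi * m%:R * x)) 0.
Proof.
move=> /freq_neq0 m0; rewrite -/(freq m); split.
  by move=> x; apply: (continuous_comp (@continuous_scale (freq m) x)); exact: continuous_cos.
exists (fun x => (freq m)^-1 * sin (freq m * x)); split; last first.
  by rewrite mulr1 mulr0 sin0 trig_freq mulr0 subrr.
move=> x; rewrite [X in is_derive _ _ _ X](_ : _ = (freq m)^-1 * (cos (freq m * x) * freq m)); last first.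
  by field.
apply: (@is_deriveZ _ _ _ (fun x => sin (freq m * x))).
exact: (is_derive1_comp (is_derive_sin (freq m * x)) (is_derive_scale (freq m) x)).
Qed.

Lemma has_mean_sin (m : nat) : (0 < m)%N -> has_mean (fun x : R => sin (2 * pi * m%:R * x)) 0.
Proof.
move=> /freq_neq0 m0; rewrite -/(freq m); split.
  by move=> x; apply: (continuous_comp (@continuous_scale (freq m) x)); exact: continuous_sin.
exists (fun x => - (freq m)^-1 * cos (freq m * x)); split; last first.
  by rewrite mulr1 mulr0 cos0 trig_freq subrr.
move=> x; rewrite [X in is_derive _ _ _ X](_ : _ = - (freq m)^-1 * (- sin (freq m * x) * freq m)); last first.
  by field.
apply: (@is_deriveZ _ _ _ (fun x => cos (freq m * x))).
exact: (is_derive1_comp (is_derive_cos (freq m * x)) (is_derive_scale (freq m) x)).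
Qed.

Lemma integral_has_mean f v : has_mean f v ->
  (\int[lebesgue_measure]_(x in `[0%R, 1%R]) (f x)%:E = v%:E)%E.
Proof.
move=> [cf [F [dF <-]]].
have cF x : {for x, continuous F}.
  by apply/differentiable_continuous/derivable1_diffP; have [] := dF x.
rewrite (@continuous_FTC2 _ f F 0 1)//.
- exact: continuous_subspaceT.
- split; first by move=> x _; have [] := dF x.
  + exact/cvg_at_right_filter/cF.
  + exact/cvg_at_left_filter/cF.
- by move=> x _; rewrite derive1E; have [_ ->] := dF x.
Qed.

Lemma has_mean_sqr_norm (al be : nat -> R) (L : nat) (c := fun n => 2 * pi * (n ^ 2)%N%:R) :
  has_mean (fun x =>
    (\sum_(0 <= n < L) (al n * cos (c n * x) + be n * sin (c n * x))) ^+ 2 +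
    (\sum_(0 <= n < L) (be n * cos (c n * x) - al n * sin (c n * x))) ^+ 2)
    (\sum_(0 <= n < L) (al n ^+ 2 + be n ^+ 2)).
Proof.
elim: L => [|L ih].
  rewrite big_geq//; apply: has_mean_ext (has_mean_cst 0) => x.
  by rewrite !big_geq// expr0n/= addr0.
rewrite big_nat_recr//=.
pose P n := 2 * (al n * al L + be n * be L).
pose Q n := 2 * (al n * be L - be n * al L).
pose d n := (L ^ 2 - n ^ 2)%N.
have cross : has_mean (fun x => \sum_(0 <= n < L)
    (P n * cos (2 * pi * (d n)%:R * x) + Q n * sin (2 * pi * (d n)%:R * x))) 0.
  apply: has_mean_sum => n nL.
  have d0 : (0 < d n)%N by rewrite subn_gt0 ltn_exp2r.
  have := has_meanD (has_meanZ (P n) (has_mean_cos d0)) (has_meanZ (Q n) (has_mean_sin d0)).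
  by rewrite !mulr0 addr0.
have := has_meanD (has_meanD ih (has_mean_cst (al L ^+ 2 + be L ^+ 2))) cross.
rewrite addr0; apply: has_mean_ext => x.
rewrite !(big_nat_recr L)//=.
set A := \sum_(0 <= n < L) (al n * _ + _); set B := \sum_(0 <= n < L) (be n * _ - _).
set C := cos (c L * x); set S := sin (c L * x).
have -> : \sum_(0 <= n < L) (P n * cos (2 * pi * (d n)%:R * x) + Q n * sin (2 * pi * (d n)%:R * x))
   = 2 * (A * (al L * C + be L * S)) + 2 * (B * (be L * C - al L * S)).
  rewrite /A /B !mulr_suml !mulr_sumr -big_split/= big_nat_cond [RHS]big_nat_cond.
  apply: eq_bigr => n /andP[/andP[_ nL] _].
  have -> : 2 * pi * (d n)%:R * x = c L * x - c n * x.
    by rewrite /d natrB ?leq_exp2r ?(ltnW nL)// /c; ring.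
  by rewrite sinB cosB -/C -/S /P /Q; ring.
have CS : C ^+ 2 + S ^+ 2 = 1 := cos2Dsin2 (c L * x).
transitivity (A ^+ 2 + B ^+ 2 + (al L ^+ 2 + be L ^+ 2) * (C ^+ 2 + S ^+ 2) +
  (2 * (A * (al L * C + be L * S)) + 2 * (B * (be L * C - al L * S)))).
  by rewrite CS mulr1.
by ring.
Qed.

End has_mean_theory.

Section l2_partial_sums.
Context (R : realType) (chi : nat -> R[i]) (s : R).

Lemma Re_mterm n x : complex.Re (mterm s chi n x) =
  complex.Re (chi n) * n%:R `^ (- s) * cos (2 * pi * (n ^ 2)%N%:R * x) +
  complex.Im (chi n) * n%:R `^ (- s) * sin (2 * pi * (n ^ 2)%N%:R * x).
Proof. by rewrite /mterm; case: (chi n) => a b /=; ring. Qed.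

Lemma Im_mterm n x : complex.Im (mterm s chi n x) =
  complex.Im (chi n) * n%:R `^ (- s) * cos (2 * pi * (n ^ 2)%N%:R * x) -
  complex.Re (chi n) * n%:R `^ (- s) * sin (2 * pi * (n ^ 2)%N%:R * x).
Proof. by rewrite /mterm; case: (chi n) => a b /=; ring. Qed.

Let cont_trig (a b k : R) : continuous (fun x => a * cos (k * x) + b * sin (k * x)).
Proof.
move=> x; apply: cvgD; apply: cvgM; try exact: cvg_cst.
  by apply: (continuous_comp (@continuous_scale R k x)); exact: continuous_cos.
by apply: (continuous_comp (@continuous_scale R k x)); exact: continuous_sin.
Qed.

Let cont_Re_mterm n : continuous (fun x : R => complex.Re (mterm s chi n x)).
Proof.
rewrite (_ : (fun x => _) = (fun x : R =>
  complex.Re (chi n) * n%:R `^ (- s) * cos (2 * pi * (n ^ 2)%N%:R * x) +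
  (complex.Im (chi n) * n%:R `^ (- s)) * sin (2 * pi * (n ^ 2)%N%:R * x))); first exact: cont_trig.
by apply/funext => x; rewrite Re_mterm.
Qed.

Let cont_Im_mterm n : continuous (fun x : R => complex.Im (mterm s chi n x)).
Proof.
rewrite (_ : (fun x => _) = (fun x : R =>
  complex.Im (chi n) * n%:R `^ (- s) * cos (2 * pi * (n ^ 2)%N%:R * x) +
  (- (complex.Re (chi n) * n%:R `^ (- s))) * sin (2 * pi * (n ^ 2)%N%:R * x))); first exact: cont_trig.
by apply/funext => x; rewrite Im_mterm mulNr.
Qed.

Lemma measurable_Re_mpartial K (D : set R) : measurable D ->
  measurable_fun D (fun x => complex.Re (mpartial s chi K x)).
Proof.
move=> mD; rewrite (funext (fun x => Re_sum _ _ _)).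
apply: measurable_sum => n.
have h := continuous_measurable_fun (@cont_Re_mterm n); exact: measurable_funTS h.
Qed.

Lemma measurable_Im_mpartial K (D : set R) : measurable D ->
  measurable_fun D (fun x => complex.Im (mpartial s chi K x)).
Proof.
move=> mD; rewrite (funext (fun x => Im_sum _ _ _)).
apply: measurable_sum => n.
have h := continuous_measurable_fun (@cont_Im_mterm n); exact: measurable_funTS h.
Qed.

Lemma mpartialB K L x : (K <= L)%N ->
  mpartial s chi L x - mpartial s chi K x = \sum_(K.+1 <= n < L.+1) mterm s chi n x.
Proof.
move=> KL; rewrite /mpartial (big_cat_nat (n := K.+1) (m := 1%N))//=.
by rewrite addrAC subrr add0r.
Qed.

Lemma integral_sqr_mpartialB K L : (K <= L)%N ->
  (\int[lebesgue_measure]_(x in `[0%R, 1%R])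
     (cmod (mpartial s chi L x - mpartial s chi K x) ^+ 2)%:E =
   (\sum_(K.+1 <= n < L.+1) cmod (chi n) ^+ 2 * n%:R `^ (- s) ^+ 2)%:E)%E.
Proof.
move=> KL.
(* The coefficients vanish up to [K], because the Parseval sum starts at 0. *)
pose al n := if (K < n)%N then complex.Re (chi n) * n%:R `^ (- s) else 0.
pose be n := if (K < n)%N then complex.Im (chi n) * n%:R `^ (- s) else 0.
have sumE (F G : nat -> R) : (forall n, (n <= K)%N -> F n = 0) -> (forall n, (K < n)%N -> F n = G n) ->
    \sum_(0 <= n < L.+1) F n = \sum_(K.+1 <= n < L.+1) G n.
  move=> F0 FG; rewrite (big_cat_nat (n := K.+1))//= big_nat_cond big1 ?add0r.
    rewrite big_nat_cond [RHS]big_nat_cond.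
    by apply: eq_bigr => n /andP[/andP[Kn _] _]; exact: FG.
  by move=> n /andP[/andP[_ nK] _]; exact: F0.
rewrite (_ : \sum_(K.+1 <= n < L.+1) _ = \sum_(0 <= n < L.+1) (al n ^+ 2 + be n ^+ 2)); last first.
  apply/esym/sumE => n; rewrite /al /be; first by rewrite ltnNge => ->/=; rewrite expr0n/= addr0.
  by move=> ->; rewrite sqr_cmod; ring.
apply: integral_has_mean; apply: has_mean_ext (has_mean_sqr_norm al be L.+1) => x.
rewrite mpartialB// sqr_cmod Re_sum Im_sum; congr (_ ^+ 2 + _ ^+ 2); apply: sumE => n.
- by rewrite /al /be ltnNge => ->/=; rewrite !mul0r addr0.
- by rewrite /al /be Re_mterm => ->.
- by rewrite /al /be ltnNge => ->/=; rewrite !mul0r subr0.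
- by rewrite /al /be Im_mterm => ->.
Qed.

Lemma integral_sqr_mpartialB_le C K L : (forall n, cmod (chi n) <= C) -> 1 / 2 < s ->
  (0 < K)%N -> (K <= L)%N ->
  (\int[lebesgue_measure]_(x in `[0%R, 1%R])
     (cmod (mpartial s chi L x - mpartial s chi K x) ^+ 2)%:E <=
   (C ^+ 2 * (K%:R `^ (- (2 * s - 1)) / (2 * s - 1)))%:E)%E.
Proof.
move=> hC s0 K0 KL; rewrite integral_sqr_mpartialB// lee_fin.
apply: (@le_trans _ _ (C ^+ 2 * \sum_(K.+1 <= n < L.+1) n%:R `^ (- (1 + (2 * s - 1))))).
  rewrite mulr_sumr; apply: ler_sum => n _.
  rewrite ler_pM ?sqr_ge0//; first by rewrite ler_pXn2r ?nnegrE ?cmod_ge0// (le_trans (cmod_ge0 (chi 0%N))).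
  rewrite -powR_mulrn ?powR_ge0// -powRrM; apply: eq_ler; congr (_ `^ _); lra.
by rewrite ler_wpM2l ?sqr_ge0//; apply: sum_powR_tail_le => //; lra.
Qed.

End l2_partial_sums.

(** * Existence of the limit *)

(** The telescoping series converges absolutely. The bound has two parts to fit the AM-GM splitting
    of the dyadic increments. *)
Lemma cvgn_of_summable_increments (R : realType) (u g : nat -> R) (mu : R) :
  0 <= mu < 1 -> (forall j, 0 <= g j) ->
  (forall j, `|u j.+1 - u j| <= mu ^+ j + g j) ->
  (\sum_(0 <= j <oo) (g j)%:E < +oo)%E -> cvgn u.
Proof.
move=> mu01 g0 hu gfin.
have sE := telescopeK u.
have uE : u = (fun n => series (telescope u) n + u 0%N).
  by rewrite sE; apply/funext => n /=; rewrite subrK.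
rewrite uE; apply: is_cvgD; last exact: is_cvg_cst.
apply: normed_cvg; apply: nondecreasing_is_cvgn.
  apply/nondecreasing_seqP => n.
  by rewrite /= seriesSr lerDl; exact: normr_ge0.
have S0 : (0 <= \sum_(0 <= j <oo) (g j)%:E)%E.
  by apply: nneseries_ge0 => n _ _; rewrite lee_fin.
exists ((1 - mu)^-1 + fine (\sum_(0 <= j <oo) (g j)%:E)%E) => _ [n _ <-].
rewrite /= seriesEnat/=; apply: (@le_trans _ _ (\sum_(0 <= j < n) (mu ^+ j + g j))).
  by apply: ler_sum => j _; exact: hu.
rewrite big_split/= lerD ?geom_sum_le//.
rewrite -lee_fin fineK; last by rewrite ge0_fin_numE.
rewrite -sumEFin; apply: nneseries_lim_ge => j _ _.
by rewrite lee_fin.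
Qed.

Lemma limn_einf_le (R : realType) (v : (\bar R)^nat) (b : \bar R) :
  (forall n, (v n <= b)%E) -> (limn_einf v <= b)%E.
Proof.
move=> vb; rewrite limn_einf_lim; apply: lime_le; first exact: is_cvg_einfs.
near=> n; apply: le_trans (vb n).
by apply: ereal_inf_lbound; exists n => /=.
Unshelve. all: by end_near. Qed.

Lemma cvg_powRN_nat (R : realType) (c : R) : 0 < c ->
  (fun n : nat => n%:R `^ (- c)) @ \oo --> (0 : R).
Proof.
move=> c0; apply/cvgrPdist_lt => e e0; near=> n.
have hn : e^-1 `^ c^-1 < n%:R by near: n; exact: nbhs_infty_gtr.
have p0 : 0 < e^-1 `^ c^-1 by rewrite powR_gt0// invr_gt0.
have n0 : 0 < n%:R :> R by exact: lt_trans hn.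
rewrite sub0r normrN ger0_norm ?powR_ge0// powRN invf_plt ?posrE ?powR_gt0//.
have -> : e^-1 = (e^-1 `^ c^-1) `^ c.
  by rewrite -powRrM mulVf ?gt_eqF// powRr1// invr_ge0 ltW.
by apply: gt0_ltr_powR => //; rewrite nnegrE ltW.
Unshelve. all: by end_near. Qed.

Section l2_limit.
Context (R : realType) (chi : nat -> R[i]) (s C : R).
Hypotheses (hC : forall n, cmod (chi n) <= C) (s0 : 1 / 2 < s).

Let D : set R := `[0%R, 1%R]%classic.
Let mD : measurable D. Proof. exact: measurable_itv. Qed.
Let c := 2 * s - 1.
Let c0 : 0 < c. Proof. by rewrite /c; move: s0 => h; lra. Qed.

Let measurable_sqr (f : R -> R[i]) :
  measurable_fun D (fun x => complex.Re (f x)) ->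
  measurable_fun D (fun x => complex.Im (f x)) ->
  measurable_fun D (fun x => (cmod (f x) ^+ 2)%:E).
Proof.
move=> mr mi; apply/measurable_EFinP.
rewrite (_ : (fun x => _) = (fun x => complex.Re (f x) ^+ 2 + complex.Im (f x) ^+ 2)).
  by apply: measurable_funD; exact: measurable_funX.
by apply/funext => x; rewrite sqr_cmod.
Qed.

Lemma measurable_sqr_mpartialB (f : R -> R[i]) K :
  measurable_fun D (fun x => complex.Re (f x)) ->
  measurable_fun D (fun x => complex.Im (f x)) ->
  measurable_fun D (fun x => (cmod (mpartial s chi K x - f x) ^+ 2)%:E).
Proof.
move=> mr mi; apply: measurable_sqr.
  rewrite (_ : (fun x => _) = (fun x => complex.Re (mpartial s chi K x) - complex.Re (f x))).
    by apply: measurable_funB => //; exact: measurable_Re_mpartial.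
  by apply/funext => x; case: mpartial (f x) => a b [].
rewrite (_ : (fun x => _) = (fun x => complex.Im (mpartial s chi K x) - complex.Im (f x))).
  by apply: measurable_funB => //; exact: measurable_Im_mpartial.
by apply/funext => x; case: mpartial (f x) => a b [].
Qed.

Let m j := mpartial s chi (2 ^ j).
Let mu : R := 2 `^ (- (c / 2)).
Let mu01 : 0 < mu < 1.
Proof. by rewrite powR_gt0//= powR2_lt1// oppr_lt0 divr_gt0. Qed.
(** The squared increments have integral of order [mu^(2 j)]. Dividing by [mu^j] keeps the integrals
    summable, while the weights [mu^j] are summable themselves. *)
Let g j x := cmod (m j.+1 x - m j x) ^+ 2 / mu ^+ j.

Let g_ge0 j x : 0 <= g j x.
Proof. by rewrite divr_ge0 ?sqr_ge0 ?exprn_ge0//; case/andP: mu01 => /ltW. Qed.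

Let mg j : measurable_fun D (fun x => (g j x)%:E).
Proof.
have := measurable_sqr_mpartialB (2 ^ j.+1) (measurable_Re_mpartial chi s (2 ^ j) mD)
  (measurable_Im_mpartial chi s (2 ^ j) mD).
move=> /measurable_EFinP h; apply/measurable_EFinP.
by apply: measurable_funM => //; exact: measurable_cst.
Qed.

Let int_g j : (\int[lebesgue_measure]_(x in D) (g j x)%:E <= (C ^+ 2 / c * mu ^+ j)%:E)%E.
Proof.
have /andP[mu0 mu1] := mu01.
have i0 : 0 <= (mu ^+ j)^-1 by rewrite invr_ge0 exprn_ge0// ltW.
rewrite (_ : (fun x => _) = (fun x => ((mu ^+ j)^-1)%:E * (cmod (m j.+1 x - m j x) ^+ 2)%:E)%E); last first.
  by apply/funext => x; rewrite /g mulrC EFinM.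
rewrite ge0_integralZl_EFin//; first last.
- exact: (measurable_sqr_mpartialB (2 ^ j.+1) (measurable_Re_mpartial chi s (2 ^ j) mD)
    (measurable_Im_mpartial chi s (2 ^ j) mD)).
- by move=> x _; rewrite lee_fin sqr_ge0.
have h := @integral_sqr_mpartialB_le R chi s C (2 ^ j) (2 ^ j.+1) hC s0 ltac:(by rewrite expn_gt0)
  ltac:(by rewrite leq_exp2l).
apply: (le_trans (lee_wpmul2l _ h)); first by rewrite lee_fin.
rewrite -EFinM lee_fin -/c powR_exp2.
have -> : 2 `^ (- c) = mu ^+ 2 :> R.
  by rewrite /mu -powR_mulrn ?powR_ge0// -powRrM; congr (_ `^ _); lra.
rewrite -exprM mulnC exprM expr2.
by apply: eq_ler; field; rewrite gt_eqF//= expf_neq0// gt_eqF.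
Qed.

Let ae_summable : {ae lebesgue_measure, forall x, D x -> (\sum_(0 <= j <oo) (g j x)%:E < +oo)%E}.
Proof.
have /andP[mu0 mu1] := mu01.
have S0 x : (0 <= \sum_(0 <= j <oo) (g j x)%:E)%E.
  by apply: nneseries_ge0 => n _ _; rewrite lee_fin.
have : lebesgue_measure.-integrable D (fun x => \sum_(0 <= j <oo) (g j x)%:E)%E.
  apply/integrableP; split.
    apply: (@ge0_emeasurable_sum _ _ _ D (fun j x => (g j x)%:E) xpredT) => [k x _ _|k _].
      by rewrite lee_fin.
    exact: mg.
  rewrite (_ : (fun x => _) = (fun x => \sum_(0 <= j <oo) (g j x)%:E)%E); last first.
    by apply/funext => x; rewrite gee0_abs.
  rewrite integral_nneseries//; last by move=> n x _; rewrite lee_fin.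
  apply: (@le_lt_trans _ _ (C ^+ 2 / c / (1 - mu))%:E); last by rewrite ltry.
  apply: lime_le; first by apply: is_cvg_nneseries => n _ _; apply: integral_ge0 => x _; rewrite lee_fin.
  near=> n.
  apply: (@le_trans _ _ (\sum_(0 <= j < n) (C ^+ 2 / c * mu ^+ j)%:E)%E).
    by apply: lee_sum => j _; exact: int_g.
  rewrite sumEFin lee_fin -mulr_sumr ler_wpM2l ?divr_ge0 ?sqr_ge0 ?(ltW c0)//.
  by apply: geom_sum_le; rewrite (ltW mu0).
move=> /integrable_ae; move=> /(_ mD); apply: filterS => x hx Dx.
by rewrite -ge0_fin_numE// hx.
Unshelve. all: by end_near. Qed.

(** The upper limit is measurable whether or not the sequence converges, and [fine] makes it real;
    the values matter only almost everywhere. *)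
Let fr x := fine (limn_esup (fun j => (complex.Re (m j x))%:E)).
Let fi x := fine (limn_esup (fun j => (complex.Im (m j x))%:E)).
Let f x : R[i] := (fr x +i* fi x)%C.

Let mfr : measurable_fun D fr.
Proof.
apply: (measurableT_comp (@fine_measurable R setT measurableT)).
by apply: measurable_fun_limn_esup => n; apply/measurable_EFinP; exact: measurable_Re_mpartial.
Qed.

Let mfi : measurable_fun D fi.
Proof.
apply: (measurableT_comp (@fine_measurable R setT measurableT)).
by apply: measurable_fun_limn_esup => n; apply/measurable_EFinP; exact: measurable_Im_mpartial.
Qed.

Let limn_esup_fine (u : nat -> R) : cvgn u -> u @ \oo --> fine (limn_esup (fun j => (u j)%:E)).
Proof.
move=> cu; have h : (fun j => (u j)%:E) @ \oo --> (limn u)%:E.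
  by apply: cvg_EFin => //; near=> n.
by rewrite (cvg_limn_einf_sup h).2.
Unshelve. all: by end_near. Qed.

Let cvg_m x : (\sum_(0 <= j <oo) (g j x)%:E < +oo)%E ->
  (fun j => complex.Re (m j x)) @ \oo --> fr x /\
  (fun j => complex.Im (m j x)) @ \oo --> fi x.
Proof.
have /andP[mu0 mu1] := mu01.
have mu01' : 0 <= mu < 1 by rewrite mu1 ltW.
move=> gx.
(* AM-GM, with the weight [mu^j]: only squares need to be integrated. *)
have amgm j (t : R) : t ^+ 2 <= cmod (m j.+1 x - m j x) ^+ 2 -> `|t| <= mu ^+ j + g j x.
  move=> h; have p0 : 0 < mu ^+ j by exact: exprn_gt0.
  rewrite -real_normK ?num_real// in h.
  have g0 := g_ge0 j x.
  have : `|t| ^+ 2 <= g j x * mu ^+ j by rewrite /g divfK ?gt_eqF.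
  move: (g j x) (mu ^+ j) g0 p0 (normr_ge0 t) => G M G0 M0; move: `|t| => z z0 hz; nra.
split; apply: limn_esup_fine; apply: (cvgn_of_summable_increments mu01' (g_ge0^~ x) _ gx) => j.
  apply: amgm; rewrite sqr_cmod.
  by case: (m j.+1 x) (m j x) => a b [a' b'] /=; rewrite lerDl sqr_ge0.
apply: amgm; rewrite sqr_cmod.
by case: (m j.+1 x) (m j x) => a b [a' b'] /=; rewrite lerDr sqr_ge0.
Qed.

Let int_limit_le K : (0 < K)%N ->
  (\int[lebesgue_measure]_(x in D) (cmod (mpartial s chi K x - f x) ^+ 2)%:E <=
    (C ^+ 2 * (K%:R `^ (- c) / c))%:E)%E.
Proof.
move=> K0.
(* The shift by [K] ensures [2^(j + K) >= K], so the Parseval tail bound holds for every [j]. *)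
pose v j x : \bar R := (cmod (m (j + K)%N x - mpartial s chi K x) ^+ 2)%:E.
have v0 j x : (0 <= v j x)%E by rewrite lee_fin sqr_ge0.
have mv j : measurable_fun D (v j).
  exact: (measurable_sqr_mpartialB (2 ^ (j + K)) (measurable_Re_mpartial chi s K mD)
    (measurable_Im_mpartial chi s K mD)).
apply: (@le_trans _ _ (\int[lebesgue_measure]_(x in D) limn_einf (v^~ x))%E); last first.
  apply: le_trans; first by apply: fatou => //; exact: mv.
  apply: limn_einf_le => j; apply: integral_sqr_mpartialB_le => //.
  by rewrite (leq_trans (ltnW (ltn_expl K (ltnSn 1))))// leq_exp2l// leq_addl.
have mL : measurable_fun D (fun x => limn_einf (v^~ x)).
  rewrite (_ : (fun x => _) = (-%E \o (fun x => limn_esup (fun n => (-%E \o v n) x)))).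
    apply: (measurableT_comp (@oppe_measurable R setT)).
    apply: measurable_fun_limn_esup => n.
    exact: (measurableT_comp (@oppe_measurable R setT) (mv n)).
  by apply/funext => x; rewrite /= -[LHS]oppeK -limn_esupN.
apply: ae_ge0_le_integral => //.
- by move=> x _; rewrite lee_fin sqr_ge0.
- exact: measurable_sqr_mpartialB.
- move=> x _; rewrite limn_einf_lim; apply: lime_ge; first exact: is_cvg_einfs.
  by near=> n; apply: le_ereal_inf_tmp => _ [k _ <-].
apply: (@filterS _ _ (ae_filter_ringOfSetsType _) _ _ _ ae_summable) => x hx Dx.
have [cr ci] := cvg_m (hx Dx).
suff h : v^~ x @ \oo --> (cmod (mpartial s chi K x - f x) ^+ 2)%:E.
  by rewrite (cvg_limn_einf_sup h).1.
apply: cvg_EFin; first by near=> n.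
have cr' : (fun j => complex.Re (m (j + K)%N x)) @ \oo --> fr x.
  by rewrite (cvg_shiftn K (fun j => complex.Re (m j x))).
have ci' : (fun j => complex.Im (m (j + K)%N x)) @ \oo --> fi x.
  by rewrite (cvg_shiftn K (fun j => complex.Im (m j x))).
rewrite -cmodN opprB sqr_cmod.
rewrite [X in X @ _ --> _](_ : _ = (fun j =>
  (complex.Re (m (j + K)%N x) - complex.Re (mpartial s chi K x)) ^+ 2 +
  (complex.Im (m (j + K)%N x) - complex.Im (mpartial s chi K x)) ^+ 2)); last first.
  apply/funext => j /=; rewrite sqr_cmod.
  by case: (m _ x) (mpartial _ _ _ _) => a b [].
have -> : complex.Re (f x - mpartial s chi K x) = fr x - complex.Re (mpartial s chi K x).
  by rewrite /f; case: mpartial.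
have -> : complex.Im (f x - mpartial s chi K x) = fi x - complex.Im (mpartial s chi K x).
  by rewrite /f; case: mpartial.
have cvg2 (u : nat -> R) (l : R) : u @ \oo --> l -> (fun j => u j ^+ 2) @ \oo --> l ^+ 2.
  by move=> h; exact: (cvgM h h).
by apply: cvgD; apply: cvg2; apply: cvgB => //; exact: cvg_cst.
Unshelve. all: by end_near. Qed.

Lemma ex_L2_limit : exists f : R -> R[i], is_L2_limit_on01 s chi f.
Proof.
exists f; split; [exact: mfr|exact: mfi|].
apply: (@squeeze_cvge _ _ _ _ (fun=> 0%E) _ (fun K : nat => (C ^+ 2 * (K%:R `^ (- c) / c))%:E)).
- near=> K; apply/andP; split.
    by apply: integral_ge0 => x _; rewrite lee_fin sqr_ge0.
  by apply: int_limit_le; near: K; exact: nbhs_infty_gt.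
- exact: cvg_cst.
apply: cvg_EFin; first by near=> n.
have : (fun K : nat => C ^+ 2 * (K%:R `^ (- c) / c)) @ \oo --> C ^+ 2 * (0 / c).
  apply: cvgM; first exact: cvg_cst.
  by apply: cvgM; [exact: cvg_powRN_nat|exact: cvg_cst].
by rewrite mul0r mulr0.
Unshelve. all: by end_near. Qed.

End l2_limit.

(** * Passage to the limit *)

Lemma L2_limit_weak_type (R : realType) (N : nat) (chi : nat -> R[i]) (s : R) (f : R -> R[i]) :
  (0 < N)%N -> (forall n, chi (n + N)%N = chi n) -> 1 / 2 < s -> s < 1 ->
  is_L2_limit_on01 s chi f ->
  exists c : R, forall alpha : R, 0 < alpha ->
    (lebesgue_measure ((interval01 R) `&` [set x | (alpha < cmod (f x))%R])
        <= (c * alpha `^ (- (2 / (1 - s))))%R%:E)%E.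
Proof.
move=> N0 chiN s0 s1 [mr mi cvf].
have [c c0 hc] := mpartial_weak_type N0 chiN s0 s1.
set p := - (2 / (1 - s)) in hc *.
exists (c * 2^-1 `^ p) => alpha a0.
have a20 : 0 < 2^-1 * alpha by rewrite mulr_gt0.
rewrite -mulrA -powRM ?(ltW a0)//.
(* [e] bounds the set where the partial sum is at least [alpha / 2] away from [f]. The partial sum
   depends on [e], but the bound at level [alpha / 2] does not, so [e] can be arbitrary. *)
apply/lee_addgt0Pr => e e0.
pose t := (2^-1 * alpha) ^+ 2.
have t0 : 0 < t by exact: exprn_gt0.
have [K0 hK] : exists K0, forall K, (K0 <= K)%N ->
    (\int[lebesgue_measure]_(x in interval01 R)
      ((cmod (mpartial s chi K x - f x)) ^+ 2)%:E <= (t * e)%:E)%E.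
  have /fine_cvgP[[K1 _ h1] /cvgrPdist_lt/(_ _ (mulr_gt0 t0 e0))[K2 _ h2]] := cvf.
  exists (maxn K1 K2) => K; rewrite geq_max => /andP[k1 k2].
  rewrite -(fineK (h1 K k1)) lee_fin.
  have := h2 K k2; rewrite /= sub0r normrN => /ltW; apply: le_trans; exact: ler_norm.
have [E [mE muE hE]] := hc K0 (2^-1 * alpha) a20.
(* This length has the form required by the weak-type bound and, being at least [K0], is also close
   to [f] in mean square. *)
set K := (2 ^ K0 * N)%N in hE.
have K0K : (K0 <= K)%N by rewrite (leq_trans (ltnW (ltn_expl K0 (ltnSn 1))))// leq_pmulr.
have mI : measurable (interval01 R) by exact: measurable_itv.
have mdiff := measurable_sqr_mpartialB chi s K mr mi.
pose G := interval01 R `&` [set x | (t%:E <= `|(cmod (mpartial s chi K x - f x) ^+ 2)%:E|)%E].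
have mG : measurable G.
  apply: emeasurable_fun_c_infty => //; exact: measurableT_comp.
have muG : (lebesgue_measure G <= e%:E)%E.
  have h2 : (\int[lebesgue_measure]_(x in interval01 R)
      `|(cmod (mpartial s chi K x - f x) ^+ 2)%:E| <= (t * e)%:E)%E.
    apply: le_trans (hK K K0K); rewrite le_eqVlt; apply/orP; left; apply/eqP.
    by apply: eq_integral => x _; rewrite gee0_abs// lee_fin sqr_ge0.
  have := le_trans (le_integral_abse lebesgue_measure mI mdiff t0) h2.
  by rewrite [(t * e)%:E]EFinM lee_pmul2l// lte_fin.
have mA : measurable (interval01 R `&` [set x | alpha < cmod (f x)]).
  rewrite (_ : [set x | _] = [set x | ((alpha ^+ 2)%:E < (cmod (f x) ^+ 2)%:E)%E]); last first.
    apply/seteqP; split => x /=; rewrite lte_fin ltr_pXn2r ?nnegrE ?cmod_ge0//; exact: ltW.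
  apply: measurable_lte => //.
  apply/measurable_EFinP.
  rewrite (_ : (fun x => _) = (fun x => complex.Re (f x) ^+ 2 + complex.Im (f x) ^+ 2)).
    by apply: measurable_funD; exact: measurable_funX.
  by apply/funext => x; rewrite sqr_cmod.
apply: (@le_trans _ _ (lebesgue_measure (E `|` G))).
  apply: le_measure; rewrite ?inE//; first exact: measurableU.
  move=> x [x01 /= ax].
  have [small|big] := ltP (2^-1 * alpha) (cmod (mpartial s chi K x)).
    by left; apply: hE => //; move: x01; rewrite /interval01/= in_itv.
  right; split => //=; rewrite lee_fin ger0_norm ?sqr_ge0// /t.
  rewrite ler_pXn2r ?nnegrE ?cmod_ge0 ?(ltW a20)//.
  have := cmodD (mpartial s chi K x) (f x - mpartial s chi K x).
  rewrite addrC subrK -(cmodN (f x - _)) opprB; lra.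
have hU := measureU2 (@lebesgue_measure R) mE mG; apply: (le_trans hU).
exact: leeD.
Qed.

Theorem theorem1 (R : realType) (N : nat) (chi : nat -> R[i]) (s : R) :
  (1 < N)%N -> primitive_character N chi -> 1 / 2 < s -> s < 1 ->
  (exists f : R -> R[i], is_L2_limit_on01 s chi f) /\
  (forall f : R -> R[i], is_L2_limit_on01 s chi f ->
    exists c : R, forall alpha : R, 0 < alpha ->
      (lebesgue_measure ((interval01 R) `&` [set x | (alpha < cmod (f x))%R])
        <= (c * alpha `^ (- (2 / (1 - s))))%R%:E)%E).
Proof.
move=> N1 [[_ _ chiN _] _] s0 s1; have N0 := ltnW N1.
split; last by move=> f; exact: (L2_limit_weak_type N0 chiN).
have [C _ hC] := chi_bounded N0 chiN.
exact: (ex_L2_limit hC s0).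
Qed.
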